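(* Let $m\in\mathbb{N}$ and let $\mathbf{C}_m$ be a given positive definite covariance matrix of $m$ consecutive samples of a wide-sense stationary process (equivalently, let admissible covariance values $c_0,c_1,\dots,c_{m-1}$ be given). Among all zero-mean wide-sense stationary processes consistent with $\mathbf{C}_m$, the minimal value of $M_\infty$ is attained by a zero-mean wide-sense stationary process with power spectral density of the form $$S(e^{j2\pi f})=\frac{1}{\sqrt{\sum_{\ell=0}^{m-1}\lambda_\ell\cos(2\pi\ell f)}}=\frac{\gamma}{\prod_{k=1}^{m-1}\left|1-\xi_k e^{-j2\pi f}\right|},$$ for the set of real numbers $\{\lambda_\ell\mid \ell=0,\dots,m-1\}$ (alternatively, for $\gamma\in\mathbb{R}_+$ and the set of complex numbers $\{\xi_k\mid k=1,\dots,m-1\}$) for which the constraints $$\int_{-1/2}^{1/2}S(e^{j2\pi f})\cos(2\pi\ell f)\,df=c_\ell,\qquad \ell=0,1,\dots,m-1,$$ are satisfied.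
   Context: For a zero-mean wide-sense stationary real-valued process $\{X_k\mid k\in\mathbb{Z}\}$, $c_\ell\triangleq\mathbb{E}\{X_{i+\ell}X_i\}$, and $\mathbf{C}_n$ is the $n\times n$ symmetric Toeplitz matrix with $(i,j)$ entry $c_{|i-j|}$. The power spectral density is $S(e^{j2\pi f})\triangleq\sum_{\ell=-\infty}^{\infty}c_\ell e^{-j2\pi f\ell}$, with $j=\sqrt{-1}$ (the sum is assumed to converge for all $f\in\mathbb{R}$). The process is consistent with a given $\mathbf{C}_m$ if the covariance matrix of $m$ consecutive samples of it equals $\mathbf{C}_m$. $M_n\triangleq\frac1n\operatorname{trace}\{\mathbf{C}_n^{-1}\}$ and $M_\infty\triangleq\lim_{n\to\infty}M_n$ (the sequence $M_n$ is non-decreasing), with the convention $\operatorname{trace}\{\mathbf{A}^{-1}\}\triangleq\infty$ for a singular positive semidefinite matrix $\mathbf{A}$. *)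

(* Defs.v *)
From HB Require Import structures.
From mathcomp Require Import all_boot all_order all_algebra.
From mathcomp Require Import all_classical all_reals all_analysis.
From mathcomp Require Import complex.

Set Implicit Arguments.
Unset Strict Implicit.
Unset Printing Implicit Defensive.

Import Order.TTheory GRing.Theory Num.Theory.
Import numFieldNormedType.Exports.
Local Open Scope classical_set_scope.
Local Open Scope ring_scope.
Local Open Scope complex_scope.

Definition toeplitz (R : realType) (n : nat) (c : nat -> R) : 'M[R]_n :=
  \matrix_(i, j) c `|(i : nat) - (j : nat)|%N.

Definition posdef (R : realType) (n : nat) (A : 'M[R]_n) : Prop :=
  A^T = A /\ forall v : 'rV[R]_n, v != 0 -> 0 < (v *m A *m v^T) 0 0.

(** Zero-mean wide-sense stationary real-valued process indexed by the integers.
    Second moments are required to be finite, so every expectation below is. *)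
Record wss_process (R : realType) := WssProcess {
  wss_display : measure_display;
  wss_sample : measurableType wss_display;
  wss_prob : probability wss_sample R;
  wss_rv : int -> {RV wss_prob >-> R};
  wss_L2 : forall k : int,
    (wss_rv k : wss_sample -> R) \in Lfun wss_prob 2%:E;
  wss_mean0 : forall k : int, ('E_wss_prob[wss_rv k] = 0)%E;
  wss_stationary : forall i l : int,
    ('E_wss_prob[(wss_rv (i + l)%R : wss_sample -> R) * wss_rv i] =
     'E_wss_prob[(wss_rv l : wss_sample -> R) * wss_rv 0%R])%E
}.

Section Processes.
Context {R : realType}.
Implicit Types X : wss_process R.

Definition autocov X (l : int) : R :=
  fine ('E_(wss_prob X)[(wss_rv X l : wss_sample X -> R) * wss_rv X 0])%E.

Definition cov_mx X (n : nat) : 'M[R]_n :=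
  toeplitz n (fun l => autocov X l%:Z).

Definition sample_cov X (k : int) (n : nat) : 'M[R]_n :=
  \matrix_(i, j) fine (covariance (wss_prob X)
    (wss_rv X (k + (i : nat)%:Z)) (wss_rv X (k + (j : nat)%:Z))).

Definition consistent X (m : nat) (C : 'M[R]_m) : Prop :=
  forall k : int, sample_cov X k m = C.

Definition cis (t : R) : R[i] := cos t +i* sin t.

(** The two-sided series is the limit of its symmetric partial sums, here with
    [l = k - N] ranging over [-N, ..., N]. *)
Definition has_psd X (S : R -> R) : Prop :=
  forall f : R,
    (fun N : nat => (\sum_(k < N.*2.+1)
       let l := (k : nat)%:Z - N%:Z in
       (autocov X l)%:C * cis (- (2 * pi * f * l%:~R))) : R[i]^o)
    @ \oo --> ((S f)%:C : R[i]^o).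

Definition trace_inv (n : nat) (A : 'M[R]_n) : \bar R :=
  if A \in unitmx then (\tr (invmx A))%:E else +oo%E.

Definition M_ X (n : nat) : \bar R :=
  ((n%:R^-1)%:E * trace_inv (cov_mx X n))%E.

Definition M_oo X : \bar R := limn (M_ X).

(** Among the processes consistent with [C] that have a power spectral density,
    some process with density [S] has minimal [M_oo]. *)
Definition psd_optimal (m : nat) (C : 'M[R]_m) (S : R -> R) : Prop :=
  exists X : wss_process R,
    [/\ has_psd X S, consistent X C &
        forall Y : wss_process R,
          (exists SY : R -> R, has_psd Y SY) -> consistent Y C ->
          (M_oo X <= M_oo Y)%E].

End Processes.

Section Densities.
Context {R : realType}.

Definition moment_constraints (m : nat) (c : nat -> R) (S : R -> R) : Prop :=
  forall l : nat, (l < m)%N ->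
    (\int[lebesgue_measure]_(f in `[(- 2^-1)%R, (2^-1)%R])
       (S f * cos (2 * pi * l%:R * f))%:E = (c l)%:E)%E.

Definition cos_poly (m : nat) (lam : 'I_m -> R) (f : R) : R :=
  \sum_(l < m) lam l * cos (2 * pi * (l : nat)%:R * f).

Definition psd_lam (m : nat) (lam : 'I_m -> R) (f : R) : R :=
  (Num.sqrt (cos_poly lam f))^-1.

Definition root_prod (n : nat) (xi : 'I_n -> R[i]) (f : R) : R :=
  \prod_(k < n) Normc.normc (1 - xi k * cis (- (2 * pi * f))).

Definition psd_xi (n : nat) (gam : R) (xi : 'I_n -> R[i]) (f : R) : R :=
  gam / root_prod xi f.

(** Strict positivity makes the formula for the density meaningful: outside it
    [Num.sqrt] and [^-1] would silently return [0]. *)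
Definition lam_solution (m : nat) (c : nat -> R) (lam : 'I_m -> R) : Prop :=
  (forall f, 0 < cos_poly lam f) /\ moment_constraints m c (psd_lam lam).

(** The density of a real-valued process is an even function of [f]. For the
    cosine form this is automatic; for the product form it restricts [xi]. *)
Definition xi_solution (m : nat) (c : nat -> R) (gam : R)
    (xi : 'I_m.-1 -> R[i]) : Prop :=
  [/\ 0 < gam, forall f, 0 < root_prod xi f,
      forall f, psd_xi gam xi (- f) = psd_xi gam xi f &
      moment_constraints m c (psd_xi gam xi)].

End Densities.

(* Main.v *)
Require Import Defs.
From HB Require Import structures.
From mathcomp Require Import all_boot all_order all_algebra.
From mathcomp Require Import all_classical all_reals all_analysis.
From mathcomp Require Import complex.
From mathcomp Require Import measurable_realfun.
From mathcomp Require Import ring lra zify.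

(* Write P for a cosine polynomial [cos_poly lam] and S = 1 / sqrt P for the
   associated density. Everything rests on weak duality. Testing the inequality
   x A^-1 x >= 2 x.y - y A y on x = the complex exponential of frequency f and
   y = sqrt (P f) x, and integrating over f, gives for every consistent process
     M_n >= 2 \int sqrt P - (1/n) tr (C_n T_n(P)),
   whose right-hand side tends to 2 \int sqrt P - sum_l lam_l c_l, the dual
   function of lam; if S has the moments c_l, this limit is \int sqrt P.
   Conversely the same inequality, integrated against S, bounds the diagonal of
   C_n^-1 by \int 1/S = \int sqrt P when S is the density.
   A solution lam exists because the dual function attains its maximum on the
   cone P >= 0: it is coercive by the Fejer-Riesz factorization, and at a
   boundary point, where P has a double zero, \int 1/sqrt(P + e) blows up.
   A process with density S is obtained by sampling
   sqrt (S f) (cos (2 pi k f) + sin (2 pi k f)) at a uniform frequency f, with a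
   random sign. The Fourier series of S converges because S is approximated
   geometrically fast by cosine polynomials, through the series of
   (1 - u)^(-1/2) at u = 1 - P / B. *)

Set Implicit Arguments.
Unset Strict Implicit.
Unset Printing Implicit Defensive.

Import Order.TTheory GRing.Theory Num.Theory.
Import numFieldNormedType.Exports.
Local Open Scope classical_set_scope.
Local Open Scope ring_scope.

(** A symbol P of degree below m makes tr (C_n T_n(P)) depend on the prescribed c_l alone; this is
    why one lower bound serves every consistent process, and why the optimal density has m
    parameters. The two bounds meet because S P = sqrt P, so that the moment constraints turn sum_l
    lam_l c_l into \int sqrt P. Existence is the delicate half: the dual function is maximized over
    an unbounded cone, and the square root is not differentiable where P vanishes. On the cone,
    positive definiteness of C_m gives sum_l lam_l c_l >= lam_0 / tau with tau = tr C_m^-1, a linear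
    growth that beats the bound 2 sqrt lam_0 on 2 \int sqrt P. Once the maximizer is known to be
    interior, its first-order conditions are exactly the moment constraints. The cosine and product
    forms are exchanged through P = K |q|^2 on the unit circle; evenness of the product form is what
    removes the sine terms of |q|^2. *)

Definition cosn (R : realType) (l : nat) (f : R) : R := cos (2 * pi * l%:R * f).
Definition sinn (R : realType) (l : nat) (f : R) : R := sin (2 * pi * l%:R * f).

Definition intI (R : realType) (g : R -> R) : R :=
  \int[lebesgue_measure]_(x in `[- 2^-1, 2^-1]) g x.

(** * Integration over one period and orthogonality of the cosines *)

Section IntegralOverPeriod.
Context {R : realType}.
Implicit Types (g h : R -> R).
Local Notation mu := (@lebesgue_measure R).

Lemma continuous_sumf (T : topologicalType) (I : Type) (r : seq I) (P : pred I)
    (F : I -> T -> R) :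
  (forall i, P i -> continuous (F i)) ->
  continuous (fun x => \sum_(i <- r | P i) F i x).
Proof.
move=> cF; elim: r => [|i r IH] x.
  under eq_fun do rewrite big_nil; exact: cvg_cst.
under eq_fun do rewrite big_cons.
case: ifPn => Pi; last exact: IH.
by apply: cvgD; [exact: cF|exact: IH].
Qed.

Lemma continuous_linear (a : R) : continuous (fun x : R => a * x).
Proof. by move=> x; apply: cvgM; [exact: cvg_cst|exact: cvg_id]. Qed.

Lemma continuous_cosn l : continuous (@cosn R l).
Proof.
move=> x; apply: (@continuous_comp _ _ _ (fun x => 2 * pi * l%:R * x) cos).
  exact: continuous_linear.
exact: continuous_cos.
Qed.

Lemma continuous_sinn l : continuous (@sinn R l).
Proof.
move=> x; apply: (@continuous_comp _ _ _ (fun x => 2 * pi * l%:R * x) sin).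
  exact: continuous_linear.
exact: continuous_sin.
Qed.

Lemma continuous_mulf (T : topologicalType) (g h : T -> R) :
  continuous g -> continuous h -> continuous (fun x => g x * h x).
Proof. by move=> cg ch x; apply: cvgM; [exact: cg|exact: ch]. Qed.

Lemma continuous_addf (T : topologicalType) (g h : T -> R) :
  continuous g -> continuous h -> continuous (fun x => g x + h x).
Proof. by move=> cg ch x; apply: cvgD; [exact: cg|exact: ch]. Qed.

Lemma continuous_subf (T : topologicalType) (g h : T -> R) :
  continuous g -> continuous h -> continuous (fun x => g x - h x).
Proof. by move=> cg ch x; apply: cvgB; [exact: cg|exact: ch]. Qed.

Lemma continuous_cstf (T : topologicalType) (a : R) : continuous (fun _ : T => a).
Proof. by move=> x; exact: cvg_cst. Qed.

Lemma continuous_sqrtf g : continuous g -> continuous (fun x => Num.sqrt (g x)).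
Proof.
move=> cg x; apply: (@continuous_comp _ _ _ g Num.sqrt); first exact: cg.
exact: sqrt_continuous.
Qed.

Lemma continuous_invf g : (forall x, g x != 0) -> continuous g ->
  continuous (fun x => (g x)^-1).
Proof. by move=> g0 cg x; apply: cvgV => //; exact: cg. Qed.

Lemma continuous_integrable g (a b : R) : continuous g ->
  mu.-integrable `[a, b] (EFin \o g).
Proof.
move=> cg; apply: continuous_compact_integrable; first exact: segment_compact.
exact: continuous_subspaceT.
Qed.
Hint Resolve continuous_integrable : core.

Lemma intID g h : continuous g -> continuous h ->
  intI (fun x => g x + h x) = intI g + intI h.
Proof. by move=> cg ch; rewrite /intI RintegralD//; exact: continuous_integrable. Qed.

Lemma intIB g h : continuous g -> continuous h ->
  intI (fun x => g x - h x) = intI g - intI h.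
Proof. by move=> cg ch; rewrite /intI RintegralB//; exact: continuous_integrable. Qed.

Lemma intIZ (a : R) g : continuous g -> intI (fun x => a * g x) = a * intI g.
Proof. by move=> cg; rewrite /intI RintegralZl//; exact: continuous_integrable. Qed.

Lemma intI_cst (a : R) : intI (fun _ => a) = a.
Proof.
rewrite /intI Rintegral_cst//= lebesgue_measure_itv/= lte_fin.
by rewrite ifT ?opprK -?EFinD /= -?splitr ?mulr1//; lra.
Qed.

Lemma eq_intI g h : g =1 h -> intI g = intI h.
Proof. by move=> /funext ->. Qed.

Lemma intI_sum (I : Type) (r : seq I) (F : I -> R -> R) :
  (forall i, continuous (F i)) ->
  intI (fun x => \sum_(i <- r) F i x) = \sum_(i <- r) intI (F i).
Proof.
move=> cF; elim: r => [|i r IH].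
  by rewrite big_nil; under eq_intI do rewrite big_nil; exact: intI_cst.
rewrite big_cons -IH -intID//; last exact: continuous_sumf.
by apply: eq_intI => x; rewrite big_cons.
Qed.

Lemma le_intI g h : continuous g -> continuous h ->
  (forall x, `[- 2^-1, 2^-1]%classic x -> g x <= h x) -> intI g <= intI h.
Proof. by move=> cg ch gh; rewrite le_Rintegral//; exact: continuous_integrable. Qed.

Lemma intI_ge0 g : (forall x, 0 <= g x) -> 0 <= intI g.
Proof. by move=> g0; exact: Rintegral_ge0. Qed.

Lemma intI_EFin g : continuous g ->
  (\int[mu]_(x in `[(- 2^-1)%R, (2^-1)%R]) (g x)%:E = (intI g)%:E)%E.
Proof.
move=> cg; rewrite /intI /Rintegral fineK//.
by apply: integrable_fin_num => //; exact: continuous_integrable.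
Qed.

Lemma intI_norm_le g (M : R) : continuous g -> (forall x, `|g x| <= M) ->
  `|intI g| <= M.
Proof.
move=> cg gM; rewrite ler_norml -(intI_cst M) -[- _]mulN1r -intIZ;
  last exact: continuous_cstf.
have cN : continuous (fun _ : R => -1 * M) by exact: continuous_cstf.
by apply/andP; split; apply: le_intI => //;
  try exact: continuous_cstf; move=> x _; have := gM x;
  rewrite ler_norml ?mulN1r => /andP[].
Qed.

Lemma intI_opp g : continuous g -> intI (fun x => g (- x)) = intI g.
Proof.
move=> cg; rewrite /intI /Rintegral.
have := @integration_by_substitution_oppr R g (- 2^-1) (2^-1).
rewrite opprK => -> //; first by lra.
exact: continuous_subspaceT.
Qed.

Lemma intI_odd g : continuous g -> (forall x, g (- x) = - g x) -> intI g = 0.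
Proof.
move=> cg og; have := intI_opp cg.
under eq_intI do rewrite og -mulN1r.
by rewrite intIZ// => ?; lra.
Qed.

Lemma sin_natpi l : sin (l%:R * pi : R) = 0.
Proof.
elim: l => [|l IH]; first by rewrite mul0r sin0.
by rewrite -natr1 mulrDl mul1r sinDpi IH oppr0.
Qed.

Lemma cosn0 x : cosn 0 x = 1 :> R.
Proof. by rewrite /cosn mulr0 mul0r cos0. Qed.

Lemma intI_cosn l : intI (@cosn R l) = (l == 0)%N%:R.
Proof.
case: l => [|l]; first by under eq_intI do rewrite cosn0; rewrite intI_cst.
have w0 : 2 * pi * l.+1%:R != 0 :> R.
  by rewrite !mulf_neq0 ?pnatr_eq0// gt_eqF// pi_gt0.
pose F (x : R) := (2 * pi * l.+1%:R)^-1 * sinn l.+1 x.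
have dF (x : R) : is_derive x 1 F (cosn l.+1 x).
  rewrite /F /sinn /cosn.
  have d1 : is_derive x 1 (fun x : R => 2 * pi * l.+1%:R * x) (2 * pi * l.+1%:R).
    have -> : (fun x : R => 2 * pi * l.+1%:R * x) =
      (2 * pi * l.+1%:R) \*: (@id R) by [].
    apply: is_derive_eq; exact: mulr1.
  have d2 : is_derive x 1 (sin \o (fun x : R => 2 * pi * l.+1%:R * x))
     (cos (2 * pi * l.+1%:R * x) *: (2 * pi * l.+1%:R)).
    by apply: is_derive1_comp.
  have -> : cos (2 * pi * l.+1%:R * x) =
      (2 * pi * l.+1%:R)^-1 *: (cos (2 * pi * l.+1%:R * x) *: (2 * pi * l.+1%:R)).
    by rewrite /GRing.scale /= mulrCA mulVf// mulr1.
  exact: is_deriveZ.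
have cF : continuous F.
  apply: continuous_mulf; [exact: continuous_cstf|exact: continuous_sinn].
rewrite /intI /Rintegral (@continuous_FTC2 R _ F)//=.
- rewrite /F /sinn.
  rewrite (_ : 2 * pi * l.+1%:R * 2^-1 = l.+1%:R * pi :> R); last by field.
  rewrite (_ : 2 * pi * l.+1%:R * - 2^-1 = - (l.+1%:R * pi) :> R); last by field.
  by rewrite sinN sin_natpi oppr0 subrr.
- by lra.
- apply: continuous_subspaceT; exact: continuous_cosn.
- split.
  + by move=> x _; exact: (@ex_derive _ _ _ _ _ _ _ (dF x)).
  + apply: cvg_at_right_filter; exact: cF.
  + apply: cvg_at_left_filter; exact: cF.
- by move=> x _; rewrite derive1E (@derive_val _ _ _ _ _ _ _ (dF x)).
Qed.

Definition absdiff (a b : nat) : nat := `|a - b|%N.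

Lemma cosn_absdiff a b x :
  cosn (absdiff a b) x = cos (2 * pi * a%:R * x - 2 * pi * b%:R * x) :> R.
Proof.
rewrite /cosn /absdiff -mulrBl -mulrBr.
have [ab|/ltnW ab] := leqP b a.
  by rewrite distnEl// natrB.
by rewrite distnEr// natrB// -cosN -mulNr -mulrN opprB.
Qed.

Lemma cosnM a b x :
  cosn a x * cosn b x = (cosn (a + b) x + cosn (absdiff a b) x) / 2 :> R.
Proof.
rewrite cosn_absdiff /cosn cosB natrD.
rewrite (_ : 2 * pi * (a%:R + b%:R) * x = 2 * pi * a%:R * x + 2 * pi * b%:R * x);
  last by ring.
by rewrite cosD; field.
Qed.

Lemma cosn_sinnM a b x :
  cosn a x * cosn b x + sinn a x * sinn b x = cosn (absdiff a b) x :> R.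
Proof. by rewrite cosn_absdiff cosB. Qed.

Lemma cosn_le1 l x : `|cosn l x| <= 1 :> R.
Proof. by rewrite ler_norml cos_geN1 cos_le1. Qed.

Lemma intI_cosnM a b : intI (fun x => @cosn R a x * cosn b x) =
  if a == b then (if a == 0%N then 1 else 2^-1) else 0.
Proof.
under eq_intI do rewrite cosnM mulrC.
rewrite intIZ; last by apply: continuous_addf; exact: continuous_cosn.
rewrite intID; try exact: continuous_cosn.
rewrite !intI_cosn addn_eq0 /absdiff distn_eq0.
case: (eqVneq a b) => [<-|ab].
  by case: (eqVneq a 0%N) => ? /=; lra.
have -> : (a == 0%N) && (b == 0%N) = false.
  by apply: contraNF ab => /andP[/eqP -> /eqP ->].
by rewrite /= addr0 mulr0.
Qed.

End IntegralOverPeriod.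

(** * Quadratic forms of symmetric matrices and of their inverses *)

Section QuadraticForms.
Context {R : realType}.

Definition qform n (A : 'M[R]_n) (x : 'rV[R]_n) : R := (x *m A *m x^T) 0 0.

Definition possemidef n (A : 'M[R]_n) : Prop :=
  A^T = A /\ forall v, 0 <= qform A v.

Lemma qformE n (A : 'M[R]_n) x :
  qform A x = \sum_i \sum_j x 0 i * A i j * x 0 j.
Proof.
rewrite /qform mxE exchange_big /=; apply: eq_bigr => j _.
by rewrite !mxE mulr_suml; apply: eq_bigr.
Qed.

Lemma qform_delta n (A : 'M[R]_n) k : qform A (delta_mx 0 k) = A k k.
Proof. by rewrite /qform -rowE trmx_delta -colE !mxE. Qed.

Lemma posdef_possemidef n (A : 'M[R]_n) : posdef A -> possemidef A.
Proof.
move=> [sA pA]; split => // v; have [->|/pA/ltW//] := eqVneq v 0.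
by rewrite /qform !mul0mx mxE.
Qed.

Lemma posdef_unitmx n (A : 'M[R]_n) : posdef A -> A \in unitmx.
Proof.
move=> [sA pA]; rewrite -row_free_unit -kermx_eq0.
apply/eqP/row_matrixP => i; rewrite row0.
apply: contraTeq isT => /pA.
by rewrite -row_mul mulmx_ker row0 mul0mx mxE ltxx.
Qed.

Lemma trmx_invmx n (A : 'M[R]_n) : A^T = A -> (invmx A)^T = invmx A.
Proof. by move=> sA; rewrite trmx_inv sA. Qed.

(** Completing the square around x A^-1, the critical point of y -> 2 x.y - y A y. It is stated for
    invertible symmetric matrices so that [possemidef_unitmx], which has yet to establish
    definiteness, can use it too. *)
Lemma qform_sub_inv n (A : 'M[R]_n) x y : A^T = A -> A \in unitmx ->
  qform A (y - x *m invmx A) =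
  qform A y - 2 * (x *m y^T) 0 0 + qform (invmx A) x.
Proof.
move=> sA uA; rewrite /qform linearB /= trmx_mul trmx_invmx//.
rewrite !(mulmxBl, mulmxBr) !mulmxKV// -!mulmxA mulKVmx// !mulmxA.
rewrite [y *m x^T](_ : _ = (x *m y^T)^T); last by rewrite trmx_mul trmxK.
rewrite !mxE; ring.
Qed.

Lemma qform_invmx_ge n (A : 'M[R]_n) x y : posdef A ->
  2 * (x *m y^T) 0 0 - qform A y <= qform (invmx A) x.
Proof.
move=> pA; have uA := posdef_unitmx pA; have [sA _] := pA.
have [_ /(_ (y - x *m invmx A))] := posdef_possemidef pA.
by rewrite qform_sub_inv//; lra.
Qed.

Lemma qform_invmx_eq n (A : 'M[R]_n) x : A^T = A -> A \in unitmx ->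
  qform (invmx A) x =
  2 * (x *m (x *m invmx A)^T) 0 0 - qform A (x *m invmx A).
Proof.
move=> sA uA; have := qform_sub_inv x (x *m invmx A) sA uA.
by rewrite subrr /qform !mul0mx mxE => ?; lra.
Qed.

(** If v A v = 0, the form at v - t v A^-1 equals - 2 t |v|^2 + t^2 Q with Q = v A^-1 v. Its
    nonnegativity for every t forces |v|^2 = 0. *)
Lemma possemidef_unitmx n (A : 'M[R]_n) :
  possemidef A -> A \in unitmx -> posdef A.
Proof.
move=> [sA pA] uA; split => // v v0; rewrite lt_neqAle pA andbT eq_sym.
apply: contra v0 => /eqP qv0.
have q2 (t : R) : 0 <= - 2 * t * (v *m v^T) 0 0 + t ^+ 2 * qform (invmx A) v.
  have := pA (v - (t *: v) *m invmx A); rewrite qform_sub_inv//.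
  rewrite {1}/qform qv0 -scalemxAl mxE.
  rewrite [qform _ (t *: v)](_ : _ = t ^+ 2 * qform (invmx A) v); first by lra.
  by rewrite /qform -!scalemxAl linearZ /= -scalemxAr !mxE; ring.
have Q0 : 0 <= qform (invmx A) v by have := q2 (-1); have := q2 1; lra.
have vv0 : (v *m v^T) 0 0 = \sum_i v 0 i ^+ 2.
  by rewrite mxE; apply: eq_bigr => i _; rewrite mxE expr2.
have s0 : 0 <= \sum_i v 0 i ^+ 2 by apply: sumr_ge0 => i _; exact: sqr_ge0.
have : \sum_i v 0 i ^+ 2 = 0.
  apply: le_anti; rewrite s0 andbT leNgt; apply/negP => sp.
  (* This t nearly minimizes the quadratic; the 1 in the denominator covers Q = 0. The value becomes
     s^2 / (1 + Q)^2 times - (Q + 2), which is negative. *)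
  have := q2 ((v *m v^T) 0 0 / (1 + qform (invmx A) v)).
  rewrite vv0; set s := \sum_i _; set Q := qform _ _ => h.
  have Q1 : 0 < 1 + Q by rewrite /Q; lra.
  have : 0 <= (s ^+ 2 / (1 + Q) ^+ 2) * (Q - 2 * (1 + Q)).
    apply: le_trans h _; rewrite le_eqVlt; apply/orP; left; apply/eqP.
    by field; rewrite gt_eqF.
  rewrite pmulr_rge0; first by rewrite /Q; lra.
  by rewrite divr_gt0// exprn_gt0.
move=> /eqP; rewrite psumr_eq0; last by move=> i _; exact: sqr_ge0.
move=> /allP h; apply/eqP/rowP => i; rewrite mxE; apply/eqP.
by have := h i; rewrite mem_index_enum sqrf_eq0 => /(_ isT).
Qed.

Section Compression.
Variables (n p : nat) (A : 'M[R]_n) (B : 'M[R]_p) (F : 'M[R]_(n, p)).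
Hypotheses (ABF : A = F *m B *m F^T) (FF : F *m F^T = 1%:M).

Lemma qform_compression y : qform A y = qform B (y *m F).
Proof. by rewrite /qform ABF trmx_mul !mulmxA. Qed.

Lemma possemidef_compression : possemidef B -> possemidef A.
Proof.
move=> [sB pB]; split; last by move=> v; rewrite qform_compression.
by rewrite ABF !trmx_mul trmxK sB mulmxA.
Qed.

Lemma posdef_compression : posdef B -> posdef A.
Proof.
move=> pB; have := possemidef_compression (posdef_possemidef pB).
case: pB => _ pB [sA _]; split => // v v0.
have := qform_compression v; rewrite {1}/qform => ->; apply: pB.
apply: contra v0 => /eqP vF0.
by rewrite -(mulmx1 v) -FF mulmxA vF0 mul0mx.
Qed.

(** x A^-1 x is the maximum of 2 x.y - y A y. Since F has orthonormal rows, the maximizer for A,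
    multiplied by F, is a competitor with the same value in the problem for B. *)
Lemma qform_invmx_compression x : posdef B ->
  qform (invmx A) x <= qform (invmx B) (x *m F).
Proof.
move=> pB; have pA := posdef_compression pB.
rewrite qform_invmx_eq; [|exact: pA.1|exact: posdef_unitmx].
rewrite qform_compression; apply: le_trans (qform_invmx_ge _ (x *m invmx A *m F) pB).
by rewrite [(_ *m _ *m F)^T]trmx_mul mulmxA -(mulmxA x F) FF mulmx1.
Qed.

End Compression.

Definition select_mx n p (f : 'I_n -> 'I_p) : 'M[R]_(n, p) :=
  \matrix_(i, j) (f i == j)%:R.

Lemma row_select n p (f : 'I_n -> 'I_p) k :
  delta_mx 0 k *m select_mx f = delta_mx 0 (f k) :> 'rV[R]_p.
Proof.
by rewrite -rowE; apply/rowP => j; rewrite !mxE eqxx eq_sym.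
Qed.

Lemma select_mxT n p (f : 'I_n -> 'I_p) : injective f ->
  select_mx f *m (select_mx f)^T = 1%:M.
Proof.
move=> fI; apply/row_matrixP => i.
rewrite !rowE mulmxA row_select mulmx1.
apply/rowP => j; rewrite -rowE !mxE eqxx /=.
by rewrite (inj_eq fI) eq_sym.
Qed.

Lemma select_compress n p (f : 'I_n -> 'I_p) (B : 'M[R]_p) :
  select_mx f *m B *m (select_mx f)^T = \matrix_(i, j) B (f i) (f j).
Proof.
apply/row_matrixP => i; rewrite rowE !mulmxA row_select.
apply/rowP => j; rewrite -rowE !mxE (bigD1 (f j)) //= big1 => [|k kj].
  by rewrite !mxE eqxx mulr1 addr0.
by rewrite !mxE eq_sym (negbTE kj) mulr0.
Qed.

Lemma toeplitz_sym n (c : nat -> R) : (toeplitz n c)^T = toeplitz n c.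
Proof. by apply/matrixP => i j; rewrite !mxE distnC. Qed.

(** * Monotonicity of the normalized trace of inverse Toeplitz matrices *)

Section ToeplitzTrace.
Variable c : nat -> R.
Hypothesis psd_c : forall n, possemidef (toeplitz n c).
Local Notation T n := (toeplitz n c).

Lemma toeplitz_widen n :
  T n = select_mx (widen_ord (leqnSn n)) *m T n.+1 *m
    (select_mx (widen_ord (leqnSn n)))^T.
Proof. by rewrite select_compress; apply/matrixP => i j; rewrite !mxE. Qed.

Lemma toeplitz_lift n :
  T n = select_mx (lift ord0) *m T n.+1 *m (select_mx (lift (@ord0 n)))^T.
Proof.
rewrite select_compress; apply/matrixP => i j; rewrite !mxE /=; congr c.
by rewrite /bump /= !add1n; lia.
Qed.

Lemma widen_ordI n p (h : (n <= p)%N) : injective (widen_ord h).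
Proof. by move=> i j /(congr1 val)/= /val_inj. Qed.

Lemma posdef_toeplitzS n : posdef (T n.+1) -> posdef (T n).
Proof.
apply: posdef_compression (toeplitz_widen n) _.
by apply: select_mxT; exact: widen_ordI.
Qed.

(** Deleting either the last or the first row and column of T (n+1) leaves T n, so entry k of the
    diagonal of (T n)^-1 is below both entries k and k+1 for T (n+1). Weighting these two bounds by
    n - k and k + 1 gives total weight n + 1 on the left and n on each entry on the right. *)
Lemma tr_invmx_toeplitzS n : posdef (T n.+1) ->
  n.+1%:R * \tr (invmx (T n)) <= n%:R * \tr (invmx (T n.+1)).
Proof.
move=> pT.
have Dw (k : 'I_n) : invmx (T n) k k <=
    invmx (T n.+1) (widen_ord (leqnSn n) k) (widen_ord (leqnSn n) k).
  rewrite -!qform_delta -row_select.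
  apply: qform_invmx_compression pT; first exact: toeplitz_widen.
  by apply: select_mxT; exact: widen_ordI.
have Dl (k : 'I_n) : invmx (T n) k k <=
    invmx (T n.+1) (lift ord0 k) (lift ord0 k).
  rewrite -!qform_delta -row_select.
  apply: qform_invmx_compression pT; first exact: toeplitz_lift.
  by apply: select_mxT; exact: lift_inj.
set D := invmx (T n.+1).
have -> : n%:R * \tr D =
    \sum_(k < n.+1) (n - k)%N%:R * D k k + \sum_(k < n.+1) (k : nat)%:R * D k k.
  rewrite -big_split mulr_sumr /=; apply: eq_bigr => k _.
  by rewrite -mulrDl -natrD subnK// -ltnS.
rewrite big_ord_recr big_ord_recl /= subnn !mul0r addr0 add0r -big_split /=.
rewrite mulr_sumr; apply: ler_sum => k _.
have -> : n.+1%:R = (n - k)%N%:R + (bump 0 k)%:R :> R.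
  by rewrite -natrD /bump /= add1n addnS subnK// ltnW.
by rewrite mulrDl lerD// ler_wpM2l.
Qed.

(** [M_ X] for a bare covariance sequence. At n = 0 the value is 0, because [0^-1 = 0] and the trace
    is empty, so the sequence starts below its other terms. *)
Definition mean_trace_inv n : \bar R := ((n%:R^-1)%:E * trace_inv (T n))%E.

Lemma invmx_diag_ge0 n (A : 'M[R]_n) k : posdef A -> 0 <= invmx A k k.
Proof.
move=> pA; rewrite -qform_delta.
by apply: le_trans (qform_invmx_ge _ 0 pA); rewrite /qform trmx0 !mulmx0 mxE; lra.
Qed.

Lemma mean_trace_inv_singular n : (T n.+1 \in unitmx) = false ->
  mean_trace_inv n.+1 = +oo%E.
Proof.
move=> uT; rewrite /mean_trace_inv /trace_inv uT mulr_infty.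
by rewrite gtr0_sg ?mul1e// invr_gt0.
Qed.

Lemma nondecreasing_mean_trace_inv :
  nondecreasing_seq mean_trace_inv.
Proof.
apply/nondecreasing_seqP => n.
have [uT|uT] := boolP (T n.+1 \in unitmx); last first.
  by rewrite (mean_trace_inv_singular (negbTE uT)) leey.
have pT := possemidef_unitmx (psd_c _) uT.
have pT' := posdef_toeplitzS pT.
rewrite /mean_trace_inv /trace_inv uT (posdef_unitmx pT') -!EFinM lee_fin.
case: n uT pT pT' => [|n] uT pT pT'.
  rewrite invr0 mul0r mulr_ge0 ?invr_ge0//.
  by apply: sumr_ge0 => k _; exact: invmx_diag_ge0.
have := tr_invmx_toeplitzS pT; set a := \tr _; set b := \tr _ => h.
rewrite mulrC ler_pdivrMr// -mulrA [_ * _%:R]mulrC mulrA [_^-1 * _]mulrC.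
by rewrite mulrAC ler_pdivlMr// mulrC.
Qed.

End ToeplitzTrace.

End QuadraticForms.

(** * Fejer-Riesz factorization of polynomials in cos t *)

Section FejerRiesz.
Local Open Scope complex_scope.
Context {R : realType}.
Local Notation normc := Normc.normc.

Definition circle_factor (xi : R[i]) (t : R) : R := normc (1 - xi * cis (- t)).

Lemma sqr_normc (a b : R) : normc (a +i* b) ^+ 2 = a ^+ 2 + b ^+ 2.
Proof. by rewrite /= sqr_sqrtr// addr_ge0// sqr_ge0. Qed.

Lemma normc_conj (z : R[i]) : normc z^* = normc z.
Proof. by case: z => a b /=; rewrite sqrrN. Qed.

Lemma normc_real (a : R) : normc a%:C = `|a|.
Proof. by rewrite /= expr0n addr0 sqrtr_sqr. Qed.

Lemma normc_gt0 (z : R[i]) : z != 0 -> 0 < normc z.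
Proof.
case: z => a b z0; rewrite /= sqrtr_gt0 lt_neqAle addr_ge0 ?sqr_ge0// andbT.
rewrite eq_sym paddr_eq0 ?sqr_ge0// !sqrf_eq0.
by apply: contra z0 => /andP[/eqP -> /eqP ->].
Qed.

Lemma circle_factor_conj xi t : circle_factor xi^* t = circle_factor xi (- t).
Proof.
rewrite /circle_factor -[in RHS]normc_conj; congr normc.
rewrite rmorphB rmorph1 rmorphM /= opprK; congr (1 - _ * _).
by rewrite /cis cosN sinN.
Qed.

(** Joukowski substitution: with z = e^(it) and xi + 1/xi = 2 r, the product (1 - xi/z)(1 - xi z) =
    1 - 2 xi cos t + xi^2 equals 2 xi (r - cos t). A linear factor in cos t thus becomes two circle
    factors. *)
Lemma circle_factor_pair (xi r : R[i]) t : xi ^+ 2 + 1 = 2 * r * xi ->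
  circle_factor xi t * circle_factor xi (- t) =
  2 * normc xi * normc (r - (cos t)%:C).
Proof.
move=> xir; rewrite /circle_factor -Normc.normcM opprK.
have -> : 2 = normc (2 : R[i]) :> R.
  by rewrite -(rmorph_nat (real_complex R)) normc_real ger0_norm.
rewrite -!Normc.normcM; congr normc.
have c1 : cis (- t) * cis t = 1 :> R[i].
  rewrite /cis cosN sinN; apply/eqP; rewrite eq_complex /=.
  by rewrite mulNr opprK -!expr2 cos2Dsin2 eqxx mulNr [cos t * _]mulrC subrr eqxx.
have c2 : cis (- t) + cis t = 2 * (cos t)%:C :> R[i].
  rewrite mulr_natl mulr2n /cis cosN sinN; apply/eqP; rewrite eq_complex /=.
  by rewrite addNr addr0 !eqxx.
transitivity (1 - xi * (cis (- t) + cis t) + xi ^+ 2 * (cis (- t) * cis t)).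
  ring.
rewrite c1 c2 mulr1 addrAC [1 + _]addrC xir; ring.
Qed.

Lemma joukowski_root (r : R[i]) : exists2 xi : R[i],
  xi ^+ 2 + 1 = 2 * r * xi & xi != 0.
Proof.
exists (r + sqrtc (r ^+ 2 - 1)).
  have h := sqr_sqrtc (r ^+ 2 - 1).
  by rewrite sqrrD h; ring.
apply/eqP => x0; have := sqr_sqrtc (r ^+ 2 - 1).
have -> : sqrtc (r ^+ 2 - 1) = - r.
  by apply/eqP; rewrite -addr_eq0 addrC x0.
rewrite sqrrN => /eqP; rewrite eq_sym subr_eq addrC -subr_eq subrr eq_sym.
by rewrite oner_eq0.
Qed.

(** For a real root r of the polynomial, necessarily outside ]-1, 1[, xi can be taken real. Then
    [circle_factor xi] is even in t, so a single xi contributes the square that matches one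
    degree. *)
Lemma joukowski_real_root (r : R) : 1 <= r ^+ 2 -> exists2 xi : R,
  xi ^+ 2 + 1 = 2 * r * xi & xi != 0.
Proof.
move=> r1; have h : Num.sqrt (r ^+ 2 - 1) ^+ 2 = r ^+ 2 - 1.
  by rewrite sqr_sqrtr// subr_ge0.
exists (r + Num.sqrt (r ^+ 2 - 1)); first by rewrite sqrrD h; ring.
apply/eqP => x0; move: h.
have -> : Num.sqrt (r ^+ 2 - 1) = - r.
  by apply/eqP; rewrite -addr_eq0 addrC x0.
by rewrite sqrrN; lra.
Qed.

(** The remainder modulo the real quadratic has degree at most 1 and vanishes at a nonreal point:
    the imaginary part kills its slope, then the real part its constant. *)
Lemma dvdp_conj_roots (p : {poly R}) (a b : R) : b != 0 ->
  root (map_poly (real_complex R) p) (a +i* b) ->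
  'X^2 - (2 * a) *: 'X + (a ^+ 2 + b ^+ 2)%:P %| p.
Proof.
move=> b0 rp; set d := 'X^2 - _ + _.
have sd : size d = 3%N.
  rewrite /d -addrA size_polyDl ?size_polyXn//.
  rewrite (leq_ltn_trans (size_polyD _ _))// gtn_max size_polyN.
  rewrite (leq_ltn_trans (size_scale_leq _ _)) ?size_polyX//=.
  by rewrite (leq_ltn_trans (size_polyC_leq1 _)).
have d0 : d != 0 by rewrite -size_poly_eq0 sd.
have dr : (map_poly (real_complex R) d).[a +i* b] = 0.
  have ev (u v : R) : (map_poly (real_complex R) ('X^2 - u *: 'X + v%:P)).[a +i* b] =
      (a +i* b) * (a +i* b) - u%:C * (a +i* b) + v%:C.
    rewrite !(rmorphD, rmorphN) /= map_polyZ map_polyXn map_polyX map_polyC /=.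
    by rewrite !hornerE expr2.
  rewrite ev; apply/eqP; rewrite eq_complex /=.
  by apply/andP; split; apply/eqP; ring.
have := divp_eq p d; set e := p %% d => pE.
have se : (size e <= 2)%N by rewrite -ltnS -sd ltn_modpN0.
apply/modp_eq0P; rewrite -/e.
have eE : e = (e`_0)%:P + (e`_1) *: 'X.
  apply/polyP => i; rewrite coefD coefC coefZ coefX.
  case: i => [|[|i]]; rewrite /= ?mulr0 ?mulr1 ?addr0 ?add0r//.
  by rewrite nth_default// (leq_trans se).
move: rp; rewrite /root pE rmorphD rmorphM hornerD hornerM dr mulr0 add0r.
rewrite eE rmorphD /= map_polyC map_polyZ map_polyX /= !hornerE.
rewrite eq_complex /= !mul0r subr0 addr0 add0r.
case/andP => h1; rewrite mulf_eq0 (negbTE b0) orbF => /eqP e1.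
move: h1; rewrite e1 mul0r addr0 => /eqP ->.
by rewrite scale0r addr0.
Qed.

(** Strong induction on the degree, stripping either a real root (one xi) or a conjugate pair (xi
    and its conjugate). Nonvanishing and [|p|] replace positivity because the quotient by x - a may
    be negative on [-1, 1]. *)
Lemma fejer_riesz_seq n (p : {poly R}) : (size p <= n.+1)%N ->
  (forall x, -1 <= x <= 1 -> p.[x] != 0) ->
  exists (K : R) (s : seq R[i]), [/\ 0 < K, (size s <= n)%N &
    forall t, `|p.[cos t]| = K * \prod_(xi <- s) circle_factor xi t ^+ 2].
Proof.
elim/ltn_ind: n p => n IH p sp p0.
have [s1|s1] := leqP (size p) 1.
  exists `|p.[1]|, [::]; split => //.
    by rewrite normr_gt0 p0// lexx andbT lerNl; lra.
  by move=> t; rewrite big_nil mulr1 (size1_polyC s1) !hornerC.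
have : exists z, root (map_poly (real_complex R) p) z.
  by apply/closed_rootP; rewrite size_map_poly neq_ltn s1 orbT.
have pn0 : p != 0 by rewrite -size_poly_eq0 -lt0n (leq_trans _ s1).
case=> -[a b] rp; have [b0|b0] := eqVneq b 0.
  have ra : root p a by move: rp; rewrite b0 fmorph_root.
  have [q qE] := factor_theorem p a ra.
  have q0 : q != 0 by apply: contraNneq pn0 => q0; rewrite qE q0 mul0r.
  have sq : size p = (size q).+1.
    by rewrite qE size_Mmonic ?monicXsubC// size_XsubC addn2.
  case: n IH sp => [|n] IH sp; first by move: s1; rewrite ltnNge sp.
  have a1 : ~~ (-1 <= a <= 1) by apply: contraL ra => /p0.
  have [|x x1|K [s [K0 ss sE]]] := IH n (ltnSn n) q.
  - by rewrite -ltnS -sq.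
  - by have := p0 _ x1; rewrite qE hornerM mulf_eq0 negb_or => /andP[].
  have [|xi xiE xi0] := @joukowski_real_root a.
    rewrite -[a ^+ 2]real_normK ?num_real// expr_ge1//.
    by move: a1; rewrite -ler_norml -ltNge; exact: ltW.
  exists (K / (2 * `|xi|)), (xi%:C :: s); split => //.
    by rewrite divr_gt0// mulr_gt0// normr_gt0.
  move=> t; rewrite big_cons qE hornerM normrM sE.
  have xic : xi%:C ^+ 2 + 1 = 2 * a%:C * xi%:C.
    by rewrite -rmorphXn -(rmorph1 (real_complex R)) -rmorphD xiE !rmorphM rmorph_nat.
  have := circle_factor_pair t xic.
  rewrite -circle_factor_conj conjc_real -expr2 => ->.
  rewrite -rmorphB !normc_real hornerXsubC distrC.
  by field; rewrite normr_eq0.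
have := dvdp_conj_roots b0 rp; set d := 'X^2 - _ + _ => /dvdpP[q qE].
have dE x : d.[x] = (a - x) ^+ 2 + b ^+ 2.
  have ev (u v : R) : ('X^2 - u *: 'X + v%:P).[x] = x ^+ 2 - u * x + v.
    by rewrite !hornerE.
  by rewrite ev; ring.
have md : size d = 3%N.
  rewrite /d -addrA size_polyDl ?size_polyXn//.
  rewrite (leq_ltn_trans (size_polyD _ _))// gtn_max size_polyN.
  rewrite (leq_ltn_trans (size_scale_leq _ _)) ?size_polyX//=.
  by rewrite (leq_ltn_trans (size_polyC_leq1 _)).
have d0 : d != 0 by rewrite -size_poly_eq0 md.
have q0 : q != 0 by apply: contraNneq pn0 => q0; rewrite qE q0 mul0r.
have sq : size p = (size q).+2 by rewrite qE size_mul// md !addnS addn0.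
case: n IH sp => [|[|n]] IH sp; first by move: s1; rewrite ltnNge sp.
  by move: sp; rewrite sq !ltnS leqn0 size_poly_eq0 (negbTE q0).
have [|x x1|K [s [K0 ss sE]]] := IH n (ltnW (ltnSn n.+1)) q.
- by rewrite -2!ltnS -sq.
- by have := p0 _ x1; rewrite qE hornerM mulf_eq0 negb_or => /andP[].
have [xi xiE xi0] := joukowski_root (a +i* b).
have nxi : 0 < normc xi by exact: normc_gt0.
(* Conjugating xi reverses t, so the two squared factors multiply to (2 |xi| |r - cos t|)^2 with r =
   a + i b, and |r - cos t|^2 is the value of the quadratic [d] at cos t. *)
exists (K / (2 * normc xi) ^+ 2), [:: xi, xi^* & s]; split => //.
  by rewrite divr_gt0// exprn_gt0// mulr_gt0.
move=> t; rewrite !big_cons qE hornerM normrM sE circle_factor_conj.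
have := circle_factor_pair t xiE => h.
rewrite [X in K / _ * X](_ : _ =
  (circle_factor xi t * circle_factor xi (- t)) ^+ 2 *
  \prod_(xi <- s) circle_factor xi t ^+ 2); last by rewrite exprMn mulrA.
rewrite h !exprMn dE ger0_norm; last by rewrite addr_ge0// sqr_ge0.
have -> : normc (a +i* b - (cos t)%:C) ^+ 2 = (a - cos t) ^+ 2 + b ^+ 2.
  by rewrite -sqr_normc; congr (normc _ ^+ 2); apply/eqP; rewrite eq_complex /= subr0 !eqxx.
by field; rewrite gt_eqF.
Qed.

Lemma fejer_riesz n (p : {poly R}) : (size p <= n.+1)%N ->
  (forall x, -1 <= x <= 1 -> 0 < p.[x]) ->
  exists (K : R) (xi : 'I_n -> R[i]), 0 < K /\
    forall t, p.[cos t] = K * \prod_k circle_factor (xi k) t ^+ 2.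
Proof.
move=> sp p0; have [|K [s [K0 ss sE]]] := fejer_riesz_seq sp.
  by move=> x /p0; rewrite lt0r => /andP[].
(* When the degree is below n the list is padded with xi = 0, whose circle factor is 1. *)
exists K, (fun k => nth 0 s k); split => // t.
have := sE t; rewrite ger0_norm; last by rewrite ltW// p0// cos_geN1 cos_le1.
move=> ->; congr (K * _).
rewrite -(big_mkord predT (fun k => circle_factor (nth 0 s k) t ^+ 2)).
rewrite (big_cat_nat _ ss)//= [X in _ = _ * X]big_nat_cond.
rewrite [X in _ = _ * X]big1 ?mulr1; first by rewrite (big_nth 0).
move=> k /andP[/andP[sk _] _]; rewrite nth_default//.
by rewrite /circle_factor mul0r subr0 Normc.normc1 expr1n.
Qed.

End FejerRiesz.

(** * Cosine polynomials: algebra, factorization, moments *)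

Section CosinePolynomials.
Local Open Scope complex_scope.
Context {R : realType}.
Implicit Types (g h : R -> R).

(** Carries two consecutive Chebyshev polynomials, so that the three-term recurrence is
    structural. *)
Fixpoint chebyshev2 (l : nat) : {poly R} * {poly R} :=
  if l is l'.+1 then
    let: (p, q) := chebyshev2 l' in (q, 2 *: ('X * q) - p)
  else (1, 'X).

Definition chebyshev l : {poly R} := (chebyshev2 l).1.

Lemma chebyshev2E l : [/\ (size (chebyshev2 l).1 <= l.+1)%N,
  (size (chebyshev2 l).2 <= l.+2)%N &
  forall t, (chebyshev2 l).1.[cos t] = cos (l%:R * t) /\
            (chebyshev2 l).2.[cos t] = cos (l.+1%:R * t)].
Proof.
elim: l => [|l]; first by split => [||t]; rewrite ?size_poly1 ?size_polyX//=
  hornerC hornerX mul0r mul1r cos0.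
rewrite /=; case: (chebyshev2 l) => p q /= [sp sq pq]; split => //.
  rewrite (leq_trans (size_polyD _ _))// geq_max size_polyN.
  rewrite (leq_trans sp) ?andbT; last by rewrite !ltnS (leq_trans (leqnSn _)).
  rewrite (leq_trans (size_scale_leq _ _))//.
  by rewrite (leq_trans (size_polyMleq _ _))// size_polyX add2n.
move=> t; split; first exact: (pq t).2.
rewrite hornerD hornerN hornerZ hornerM hornerX (pq t).1 (pq t).2.
have -> : l%:R * t = l.+1%:R * t - t by rewrite -natr1; ring.
have -> : l.+2%:R * t = l.+1%:R * t + t by rewrite -natr1; ring.
by rewrite cosB cosD; ring.
Qed.

Lemma size_chebyshev l : (size (chebyshev l) <= l.+1)%N.
Proof. by have [] := chebyshev2E l. Qed.

Lemma horner_chebyshev l t : (chebyshev l).[cos t] = cos (l%:R * t).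
Proof. by have [_ _ /(_ t)[]] := chebyshev2E l. Qed.

Lemma cosnE l f : cosn l f = cos (l%:R * (2 * pi * f)) :> R.
Proof. by rewrite /cosn; congr cos; ring. Qed.

(** Existential form of [cos_poly], so that sums, multiples and products can be formed without
    tracking coefficients. *)
Definition even_trig n g :=
  exists lam : 'I_n -> R, forall f, g f = cos_poly lam f.

Lemma even_trig_poly n g : even_trig n g ->
  exists p : {poly R}, (size p <= n)%N /\ forall f, g f = p.[cos (2 * pi * f)].
Proof.
case=> lam gE; exists (\sum_(l < n) lam l *: chebyshev l); split.
  rewrite (leq_trans (size_sum _ _ _))//; apply/bigmax_leqP => l _.
  by rewrite (leq_trans (size_scale_leq _ _))// (leq_trans (size_chebyshev _)).
move=> f; rewrite gE horner_sum; apply: eq_bigr => l _.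
by rewrite hornerZ horner_chebyshev -cosnE.
Qed.

(** The solution is taken in [-1/2, 0] so that the half period to its right stays inside
    [-1/2, 1/2]; [inv_sqrt_unbounded] integrates over that half period. *)
Lemma cos_range (x : R) : -1 <= x <= 1 ->
  exists2 f : R, - 2^-1 <= f <= 0 & cos (2 * pi * f) = x.
Proof.
move=> x1; have [/andP[h1 h2] h] := acos_def x1; have p0 := @pi_gt0 R.
exists (- (acos x / (2 * pi))); last first.
  by rewrite mulrN cosN mulrC divfK// mulf_neq0// gt_eqF.
apply/andP; split; last by rewrite oppr_le0 divr_ge0// mulr_ge0// ltW.
by rewrite lerN2 ler_pdivrMr ?mulr_gt0//; lra.
Qed.

Lemma cos_poly_cosn n (lam : 'I_n -> R) f :
  cos_poly lam f = \sum_(l < n) lam l * cosn l f.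
Proof. by []. Qed.

Lemma continuous_cos_poly n (lam : 'I_n -> R) : continuous (cos_poly lam).
Proof.
apply: continuous_sumf => l _; apply: continuous_mulf.
  exact: continuous_cstf.
exact: continuous_cosn.
Qed.

Lemma cos_polyN n (lam : 'I_n -> R) f : cos_poly lam (- f) = cos_poly lam f.
Proof. by apply: eq_bigr => l _; rewrite mulrN cosN. Qed.

Lemma cos_poly_min n (lam : 'I_n -> R) : exists2 f0 : R, - 2^-1 <= f0 <= 0 &
  forall f, cos_poly lam f0 <= cos_poly lam f.
Proof.
have [p [_ pE]] : exists p : {poly R}, (size p <= n)%N /\
    forall f, cos_poly lam f = p.[cos (2 * pi * f)].
  by apply: even_trig_poly; exists lam.
have [||x x1 xmin] := @EVT_min R (horner p) (-1) 1; first by lra.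
  by apply: continuous_subspaceT; exact: continuous_horner.
have [f0 f01 f0x] : exists2 f : R, - 2^-1 <= f <= 0 & cos (2 * pi * f) = x.
  by apply: cos_range; move: x1; rewrite in_itv.
exists f0 => // f; rewrite !pE f0x; apply: xmin.
by rewrite in_itv /= cos_geN1 cos_le1.
Qed.

Lemma cos_poly_le n (lam : 'I_n -> R) f :
  `|cos_poly lam f| <= \sum_l `|lam l|.
Proof.
apply: le_trans (ler_norm_sum _ _ _) _; apply: ler_sum => l _.
by rewrite normrM ler_piMr// cosn_le1.
Qed.

Lemma even_trig_cosn n l : (l < n)%N -> even_trig n (@cosn R l).
Proof.
move=> ln; exists (fun i => (i == Ordinal ln)%:R) => f.
rewrite cos_poly_cosn (bigD1 (Ordinal ln))//= eqxx mul1r big1 ?addr0// => i.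
by move=> /negbTE ->; rewrite mul0r.
Qed.

Lemma even_trigD n g h : even_trig n g -> even_trig n h ->
  even_trig n (fun f => g f + h f).
Proof.
move=> [lam gE] [lam' hE]; exists (fun i => lam i + lam' i) => f.
rewrite gE hE !cos_poly_cosn -big_split /=; apply: eq_bigr => i _.
by rewrite mulrDl.
Qed.

Lemma even_trigZ n a g : even_trig n g -> even_trig n (fun f => a * g f).
Proof.
move=> [lam gE]; exists (fun i => a * lam i) => f.
rewrite gE !cos_poly_cosn mulr_sumr; apply: eq_bigr => i _.
by rewrite mulrA.
Qed.

Lemma eq_even_trig n g h : g =1 h -> even_trig n g -> even_trig n h.
Proof. by move=> /funext ->. Qed.

Lemma even_trig_sum n (I : Type) (r : seq I) (F : I -> R -> R) :
  (forall i, even_trig n (F i)) ->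
  even_trig n (fun f => \sum_(i <- r) F i f).
Proof.
move=> tF; elim: r => [|i r IH].
  exists (fun=> 0) => f; rewrite big_nil cos_poly_cosn big1// => i _.
  by rewrite mul0r.
apply: (@eq_even_trig n (fun f => F i f + \sum_(i <- r) F i f)).
  by move=> f; rewrite big_cons.
exact: even_trigD.
Qed.

Lemma absdiff_lt n a b : (a < n)%N -> (b < n)%N -> (absdiff a b < n)%N.
Proof.
rewrite /absdiff; have [ab|/ltnW ab] := leqP b a => an bn.
  by rewrite distnEl// (leq_ltn_trans (leq_subr _ _)).
by rewrite distnEr// (leq_ltn_trans (leq_subr _ _)).
Qed.

Lemma even_trigM n p g h : even_trig n.+1 g -> even_trig p.+1 h ->
  even_trig (n + p).+1 (fun f => g f * h f).
Proof.
move=> [lam gE] [lam' hE].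
apply: (@eq_even_trig _ (fun f => \sum_(i < n.+1) \sum_(j < p.+1)
    lam i * lam' j * 2^-1 * (cosn (i + j) f + cosn (absdiff i j) f))).
  move=> f; rewrite gE hE !cos_poly_cosn mulr_suml; apply: eq_bigr => i _.
  rewrite mulr_sumr; apply: eq_bigr => j _; rewrite mulrACA cosnM; ring.
apply: even_trig_sum => i; apply: even_trig_sum => j; apply: even_trigZ.
have hi := ltn_ord i; have hj := ltn_ord j.
apply: even_trigD; apply: even_trig_cosn; first by rewrite ltnS leq_add.
by apply: absdiff_lt; [apply: leq_trans hi _; rewrite ltnS leq_addr|
  apply: leq_trans hj _; rewrite ltnS leq_addl].
Qed.

Lemma root_prod_circle n (xi : 'I_n -> R[i]) f :
  root_prod xi f = \prod_k circle_factor (xi k) (2 * pi * f).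
Proof. by []. Qed.

Lemma cis_exp t n : cis (- t) ^+ n = cos (n%:R * t) -i* sin (n%:R * t) :> R[i].
Proof.
elim: n => [|n IH]; first by rewrite expr0 mul0r cos0 sin0 oppr0.
have -> : n.+1%:R * t = n%:R * t + t by rewrite -natr1; ring.
rewrite exprS IH cosD sinD /cis cosN sinN; apply/eqP; rewrite eq_complex /=.
by apply/andP; split; apply/eqP; ring.
Qed.

Lemma Re_sum (I : Type) (r : seq I) (F : I -> R[i]) :
  complex.Re (\sum_(i <- r) F i) = \sum_(i <- r) complex.Re (F i).
Proof.
elim: r => [|i r IH]; rewrite ?big_nil// !big_cons -IH.
by case: (F i); case: (\sum_(j <- r) F j).
Qed.

Lemma Im_sum (I : Type) (r : seq I) (F : I -> R[i]) :
  complex.Im (\sum_(i <- r) F i) = \sum_(i <- r) complex.Im (F i).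
Proof.
elim: r => [|i r IH]; rewrite ?big_nil// !big_cons -IH.
by case: (F i); case: (\sum_(j <- r) F j).
Qed.

(* Symmetrizing in [f] kills the sine terms of [|q(e^(-2 pi i f))|^2], where
   [q = \prod_k (1 - xi k X)] has coefficients [u a + i v a]. *)
Lemma root_prod_sym n (xi : 'I_n -> R[i]) : exists u v : 'rV[R]_n.+1,
  forall f, (root_prod xi f ^+ 2 + root_prod xi (- f) ^+ 2) / 2 =
    \sum_a \sum_b (u 0 a * u 0 b + v 0 a * v 0 b) * cosn (absdiff a b) f.
Proof.
pose q : {poly R[i]} := \prod_k (1 - xi k *: 'X).
have sq : (size q <= n.+1)%N.
  rewrite (leq_trans (size_prod_leq _ _))//.
  rewrite (@leq_trans ((\sum_(k < n) 2).+1 - #|'I_n|))//.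
    rewrite leq_sub2r// ltnS leq_sum// => k _.
    rewrite (leq_trans (size_polyD _ _))// geq_max size_poly1 size_polyN /=.
    by rewrite (leq_trans (size_scale_leq _ _))// size_polyX.
  by rewrite sum_nat_const card_ord; lia.
exists (\row_a complex.Re q`_a), (\row_a complex.Im q`_a) => f.
have rE (t : R) : (\prod_k circle_factor (xi k) t) ^+ 2 =
    (\sum_(a < n.+1) (complex.Re q`_a * cos (a%:R * t) + complex.Im q`_a * sin (a%:R * t))) ^+ 2 +
    (\sum_(a < n.+1) (complex.Im q`_a * cos (a%:R * t) - complex.Re q`_a * sin (a%:R * t))) ^+ 2.
  rewrite -sqr_normc; congr (_ ^+ 2).
  transitivity (Normc.normc q.[cis (- t)]).
    rewrite /q horner_prod (big_morph _ (@Normc.normcM R) (@Normc.normc1 R)).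
    apply: eq_bigr => k _; congr Normc.normc.
    by rewrite !hornerE.
  congr Normc.normc; rewrite (horner_coef_wide _ sq).
  apply/eqP; rewrite eq_complex Re_sum Im_sum /=.
  by apply/andP; split; apply/eqP/eq_bigr => a _; rewrite cis_exp;
    case: (q`_a) => x y /=; ring.
rewrite !root_prod_circle !rE !expr2 !mulr_suml -!big_split /= mulr_suml.
apply: eq_bigr => a _.
rewrite !mulr_sumr -!big_split /= mulr_suml; apply: eq_bigr => b _.
rewrite cosn_absdiff cosB !mxE mulrN.
rewrite (_ : 2 * pi * a%:R * f = a%:R * (2 * pi * f)); last by ring.
rewrite (_ : 2 * pi * b%:R * f = b%:R * (2 * pi * f)); last by ring.
rewrite !mulrN !cosN !sinN.
by field.
Qed.

(** For an even product the symmetrized square of [root_prod_sym] is the square itself. *)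
Lemma root_prod_even_trig n (xi : 'I_n -> R[i]) :
  (forall f, root_prod xi (- f) = root_prod xi f) ->
  even_trig n.+1 (fun f => root_prod xi f ^+ 2).
Proof.
move=> ev; have [u [v uv]] := root_prod_sym xi.
apply: eq_even_trig.
  by move=> f; rewrite -[RHS](_ : (root_prod xi f ^+ 2 + root_prod xi (- f) ^+ 2) / 2 = _);
    [exact/esym/uv|rewrite ev; field].
apply: even_trig_sum => a; apply: even_trig_sum => b; apply: even_trigZ.
by apply: even_trig_cosn; exact: absdiff_lt.
Qed.

Lemma cos_poly_root_prod n (lam : 'I_n.+1 -> R) :
  (forall f, 0 < cos_poly lam f) -> exists (K : R) (xi : 'I_n -> R[i]), 0 < K /\
    forall f, cos_poly lam f = K * root_prod xi f ^+ 2.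
Proof.
move=> P0; have [p [sp pE]] : exists p : {poly R}, (size p <= n.+1)%N /\
    forall f, cos_poly lam f = p.[cos (2 * pi * f)].
  by apply: even_trig_poly; exists lam.
have [|K [xi [K0 KE]]] := fejer_riesz sp.
  by move=> x /cos_range[f _ <-]; rewrite -pE.
exists K, xi; split => // f.
by rewrite pE KE root_prod_circle prodrXl.
Qed.

(** A trigonometric polynomial, of no particular sign, whose first m cosine moments are c; the
    factor 2 offsets \int cos^2 = 1/2. It turns the linear functional lam -> sum_l lam_l c_l into an
    integral against P. *)
Definition moment_kernel m (c : nat -> R) (f : R) : R :=
  \sum_(l < m) (if l == 0%N :> nat then 1 else 2) * c l * cosn l f.

Lemma continuous_moment_kernel m c : continuous (moment_kernel m c).
Proof.
apply: continuous_sumf => l _; apply: continuous_mulf.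
  exact: continuous_cstf.
exact: continuous_cosn.
Qed.

Lemma intI_cosn_kernel m c l : (l < m)%N ->
  intI (fun f => cosn l f * moment_kernel m c f) = c l.
Proof.
move=> lm.
under eq_intI do rewrite mulr_sumr.
rewrite intI_sum; last first.
  move=> i; apply: continuous_mulf; first exact: continuous_cosn.
  by apply: continuous_mulf; [exact: continuous_cstf|exact: continuous_cosn].
rewrite (bigD1 (Ordinal lm))//= big1 ?addr0.
  under eq_intI do rewrite mulrCA.
  rewrite intIZ; last by apply: continuous_mulf; exact: continuous_cosn.
  by rewrite intI_cosnM eqxx; case: eqVneq => _; field.
move=> i il; under eq_intI do rewrite mulrCA.
rewrite intIZ; last by apply: continuous_mulf; exact: continuous_cosn.
rewrite intI_cosnM; case: (eqVneq l i) => [li|_]; last by rewrite mulr0.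
by move: il; rewrite -val_eqE /= -li eqxx.
Qed.

Lemma intI_cos_poly_mul n (lam : 'I_n -> R) g : continuous g ->
  intI (fun f => cos_poly lam f * g f) =
  \sum_l lam l * intI (fun f => cosn l f * g f).
Proof.
move=> cg; under eq_intI do rewrite mulr_suml.
rewrite intI_sum.
  apply: eq_bigr => l _; rewrite -intIZ.
    by apply: eq_intI => f; rewrite mulrA.
  by apply: continuous_mulf => //; exact: continuous_cosn.
move=> l; apply: continuous_mulf => //; apply: continuous_mulf.
  exact: continuous_cstf.
exact: continuous_cosn.
Qed.

Lemma intI_cos_poly_kernel m c (lam : 'I_m -> R) :
  intI (fun f => cos_poly lam f * moment_kernel m c f) = \sum_l lam l * c l.
Proof.
rewrite intI_cos_poly_mul; last exact: continuous_moment_kernel.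
by apply: eq_bigr => l _; rewrite intI_cosn_kernel.
Qed.

Lemma intI_cos_poly n (lam : 'I_n.+1 -> R) : intI (cos_poly lam) = lam ord0.
Proof.
have := intI_cos_poly_mul lam (@continuous_cstf R R 1).
under eq_intI do rewrite mulr1; move=> ->.
rewrite (bigD1 ord0)//= big1 ?addr0; last first.
  move=> i i0; under eq_intI do rewrite mulr1; rewrite intI_cosn.
  by rewrite -[_ == _]/(i == ord0) (negbTE i0) mulr0.
by under eq_intI do rewrite mulr1; rewrite intI_cosn mulr1.
Qed.

Lemma intI_double_sum n (w : 'I_n -> 'I_n -> R) g : continuous g ->
  intI (fun f => (\sum_a \sum_b w a b * cosn (absdiff a b) f) * g f) =
  \sum_a \sum_b w a b * intI (fun f => cosn (absdiff a b) f * g f).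
Proof.
move=> cg; under eq_intI do rewrite mulr_suml.
have cc a b : continuous (fun f => w a b * (cosn (absdiff a b) f * g f)).
  apply: continuous_mulf; first exact: continuous_cstf.
  by apply: continuous_mulf => //; exact: continuous_cosn.
rewrite (_ : intI _ =
  intI (fun f => \sum_a \sum_b w a b * (cosn (absdiff a b) f * g f))); last first.
  apply: eq_intI => f; apply: eq_bigr => a _; rewrite mulr_suml.
  by apply: eq_bigr => b _; rewrite mulrA.
rewrite intI_sum; last by move=> a; exact: continuous_sumf.
apply: eq_bigr => a _; rewrite intI_sum//; apply: eq_bigr => b _.
by rewrite intIZ//; apply: continuous_mulf => //; exact: continuous_cosn.
Qed.

End CosinePolynomials.

(** * Coercivity, and lower and upper bounds on the limiting mean trace *)

Section Bounds.
Context {R : realType}.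
Implicit Types (c : nat -> R) (S : R -> R).

Lemma dot_sumE n (x y : 'rV[R]_n) : (x *m y^T) 0 0 = \sum_i x 0 i * y 0 i.
Proof. by rewrite mxE; apply: eq_bigr => i _; rewrite mxE. Qed.

(** Cauchy-Schwarz for the dual norms of A^-1 and A: the variational inequality is tested on t y, at
    the optimal t = y_k / (y A y). *)
Lemma sqr_coord_le n (A : 'M[R]_n) (y : 'rV[R]_n) k : posdef A ->
  y 0 k ^+ 2 <= invmx A k k * qform A y.
Proof.
move=> pA; have [->|y0] := eqVneq y 0.
  by rewrite /qform !mul0mx !mxE expr0n mulr0.
have q0 : 0 < qform A y by exact: pA.2.
have := qform_invmx_ge (delta_mx 0 k) ((y 0 k / qform A y) *: y) pA.
rewrite qform_delta; set t := _ / _.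
have -> : qform A (t *: y) = t ^+ 2 * qform A y.
  by rewrite /qform -!scalemxAl linearZ /= -scalemxAr !mxE; ring.
have -> : ((delta_mx 0 k : 'rV[R]_n) *m (t *: y)^T) 0 0 = t * y 0 k.
  by rewrite -rowE !mxE.
move=> h; rewrite -ler_pdivrMr//; apply: le_trans h.
by rewrite le_eqVlt; apply/orP; left; apply/eqP; rewrite /t; field; rewrite gt_eqF.
Qed.

Lemma sumsqr_le_qform n (A : 'M[R]_n) (y : 'rV[R]_n) : posdef A ->
  \sum_k y 0 k ^+ 2 <= \tr (invmx A) * qform A y.
Proof.
by move=> pA; rewrite mulr_suml; apply: ler_sum => k _; exact: sqr_coord_le.
Qed.

Lemma intI_cosn_absdiff n (a b : 'I_n) : intI (@cosn R (absdiff a b)) = (b == a)%:R.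
Proof. by rewrite intI_cosn /absdiff distn_eq0 eq_sym. Qed.

(** Factor P = K |q|^2 and let u + i v be the coefficients of q. Then lam_0 = \int P = K (|u|^2 +
    |v|^2), while sum_l lam_l c_l = K (u T u + v T v), and tr T^-1 controls the ratio. *)
Lemma coercive_gt0 n c (lam : 'I_n.+1 -> R) : posdef (toeplitz n.+1 c) ->
  (forall f, 0 < cos_poly lam f) ->
  lam ord0 <= \tr (invmx (toeplitz n.+1 c)) * \sum_l lam l * c l.
Proof.
move=> pT P0; have [K [xi [K0 PE]]] := cos_poly_root_prod P0.
have [u [v uvE]] := root_prod_sym xi.
pose w a b := K * (u 0 a * u 0 b + v 0 a * v 0 b).
have PW f : cos_poly lam f = \sum_a \sum_b w a b * cosn (absdiff a b) f.
  have -> : cos_poly lam f = K * ((root_prod xi f ^+ 2 + root_prod xi (- f) ^+ 2) / 2).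
    by rewrite mulrA mulrDr -!PE cos_polyN; field.
  rewrite uvE mulr_sumr; apply: eq_bigr => a _; rewrite mulr_sumr.
  by apply: eq_bigr => b _; rewrite mulrA.
have int_mul g : continuous g -> intI (fun f => cos_poly lam f * g f) =
    \sum_a \sum_b w a b * intI (fun f => cosn (absdiff a b) f * g f).
  by move=> cg; under eq_intI do rewrite PW; exact: intI_double_sum.
have -> : lam ord0 = K * (\sum_k u 0 k ^+ 2 + \sum_k v 0 k ^+ 2).
  rewrite -intI_cos_poly -[cos_poly lam](_ : (fun f => cos_poly lam f * 1) = _);
    last by apply/funext => f; rewrite mulr1.
  rewrite int_mul; last exact: continuous_cstf.
  rewrite -big_split mulr_sumr /=; apply: eq_bigr => a _.
  rewrite (bigD1 a)//= big1 ?addr0 => [|b ba].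
    under eq_intI do rewrite mulr1.
    by rewrite intI_cosn /absdiff distnn /= mulr1 /w !expr2.
  under eq_intI do rewrite mulr1.
  by rewrite intI_cosn_absdiff (negbTE ba) mulr0.
rewrite -intI_cos_poly_kernel int_mul; last exact: continuous_moment_kernel.
have -> : \sum_a \sum_b w a b *
    intI (fun f => cosn (absdiff a b) f * moment_kernel n.+1 c f) =
    K * (qform (toeplitz n.+1 c) u + qform (toeplitz n.+1 c) v).
  rewrite !qformE -big_split mulr_sumr /=; apply: eq_bigr => a _.
  rewrite -big_split mulr_sumr /=; apply: eq_bigr => b _.
  by rewrite intI_cosn_kernel ?absdiff_lt// !mxE /w /absdiff; ring.
rewrite mulrCA ler_pM2l// mulrDr lerD//; exact: sumsqr_le_qform.
Qed.

Definition shift_coef n (lam : 'I_n.+1 -> R) (e : R) (l : 'I_n.+1) : R :=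
  lam l + (if l == ord0 then e else 0).

Lemma shift_coef_sum n (lam : 'I_n.+1 -> R) e (g : 'I_n.+1 -> R) :
  \sum_l shift_coef lam e l * g l = \sum_l lam l * g l + e * g ord0.
Proof.
under eq_bigr do rewrite mulrDl.
rewrite big_split /=; congr (_ + _).
rewrite (bigD1 ord0)//= big1 ?addr0// => i /negbTE ->.
by rewrite mul0r.
Qed.

Lemma cos_poly_shift n (lam : 'I_n.+1 -> R) e f :
  cos_poly (shift_coef lam e) f = cos_poly lam f + e.
Proof.
by rewrite cos_poly_cosn (shift_coef_sum lam e (fun l => cosn l f)) cosn0 mulr1.
Qed.

Lemma coercive n c (lam : 'I_n.+1 -> R) : posdef (toeplitz n.+1 c) ->
  (forall f, 0 <= cos_poly lam f) ->
  lam ord0 <= \tr (invmx (toeplitz n.+1 c)) * \sum_l lam l * c l.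
Proof.
move=> pT P0; set t := \tr _; apply/ler_addgt0Pr => e e0.
(* Adding d to P makes it positive at the cost of d t c_0 on the right-hand side; this d keeps that
   cost below e. *)
pose d := e / (`|t * c 0%N| + 1).
have d0 : 0 < d by rewrite divr_gt0// ltr_wpDl.
have := @coercive_gt0 _ c (shift_coef lam d) pT.
rewrite shift_coef_sum /shift_coef eqxx -/t => h.
have : lam ord0 + d <= t * (\sum_l lam l * c l + d * c 0%N).
  by apply: h => f; rewrite cos_poly_shift ltr_wpDl.
have : d * (t * c 0%N) <= e.
  apply: (@le_trans _ _ (d * (`|t * c 0%N| + 1))).
    by rewrite ler_pM2l// (le_trans (ler_norm _))// lerDl.
  by rewrite /d divfK// gt_eqF// ltr_wpDl.
by rewrite mulrDr [t * (d * _)]mulrCA; lra.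
Qed.

Lemma toeplitz_qform_cossin n (A : 'M[R]_n) f :
  qform A (\row_k cosn k f) + qform A (\row_k sinn k f) =
  \sum_j \sum_k A j k * cosn (absdiff j k) f.
Proof.
rewrite !qformE -big_split /=; apply: eq_bigr => j _.
rewrite -big_split /=; apply: eq_bigr => k _.
by rewrite !mxE -cosn_sinnM; ring.
Qed.

Lemma sum_cos2_sin2 n f : \sum_(k < n) (cosn k f ^+ 2 + sinn k f ^+ 2) = n%:R :> R.
Proof.
under eq_bigr do rewrite cos2Dsin2.
by rewrite sumr_const card_ord.
Qed.

Lemma intI_double_sum1 n (w : 'I_n -> 'I_n -> R) :
  intI (fun f => \sum_a \sum_b w a b * cosn (absdiff a b) f) = \sum_a w a a.
Proof.
have := intI_double_sum w (@continuous_cstf R R 1).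
under eq_intI do rewrite mulr1; move=> ->; apply: eq_bigr => a _.
rewrite (bigD1 a)//= big1 ?addr0 => [|b ba].
  under eq_intI do rewrite mulr1.
  by rewrite intI_cosn /absdiff distnn mulr1.
under eq_intI do rewrite mulr1.
by rewrite intI_cosn_absdiff (negbTE ba) mulr0.
Qed.

Lemma continuous_double_sum n (w : 'I_n -> 'I_n -> R) :
  continuous (fun f => \sum_a \sum_b w a b * cosn (absdiff a b) f).
Proof.
apply: continuous_sumf => a _; apply: continuous_sumf => b _.
by apply: continuous_mulf; [exact: continuous_cstf|exact: continuous_cosn].
Qed.

(* For every symbol [P >= 0], testing [x A^-1 x >= 2 x.y - y A y] on
   [y = sqrt (P f) x], with [x] the complex exponential of frequency [f], and
   integrating over [f] leaves only [n] moments of [P]. *)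
Lemma tr_invmx_ge n c (P : R -> R) : posdef (toeplitz n c) ->
  continuous P -> (forall f, 0 <= P f) ->
  2 * n%:R * intI (fun f => Num.sqrt (P f)) -
    \sum_(j < n) \sum_(k < n) c (absdiff j k) *
      intI (fun f => cosn (absdiff j k) f * P f) <=
  \tr (invmx (toeplitz n c)).
Proof.
move=> pT cP P0.
have cs : continuous (fun f => Num.sqrt (P f)) by exact: continuous_sqrtf.
pose w (j k : 'I_n) := c (absdiff j k).
rewrite -(intI_double_sum w cP) -intIZ// -intIB; first last.
- by apply: continuous_mulf => //; exact: continuous_double_sum.
- by apply: continuous_mulf => //; exact: continuous_cstf.
rewrite -[\tr _](intI_double_sum1 (fun j k => invmx (toeplitz n c) j k)).
apply: le_intI.
- apply: continuous_subf; first by apply: continuous_mulf => //; exact: continuous_cstf.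
  by apply: continuous_mulf => //; exact: continuous_double_sum.
- exact: continuous_double_sum.
move=> f _; rewrite -toeplitz_qform_cossin.
have -> : \sum_a \sum_b w a b * cosn (absdiff a b) f =
  qform (toeplitz n c) (\row_k cosn k f) + qform (toeplitz n c) (\row_k sinn k f).
  rewrite toeplitz_qform_cossin; apply: eq_bigr => a _; apply: eq_bigr => b _.
  by rewrite mxE.
set s := Num.sqrt (P f); set x := \row_k _; set y := \row_k _.
have sP : s ^+ 2 = P f by rewrite sqr_sqrtr.
have := qform_invmx_ge x (s *: x) pT; have := qform_invmx_ge y (s *: y) pT.
have sc z : qform (toeplitz n c) (s *: z) = P f * qform (toeplitz n c) z.
  by rewrite -sP /qform -!scalemxAl linearZ /= -scalemxAr !mxE; ring.
have dt (z : 'rV[R]_n) : (z *m (s *: z)^T) 0 0 = s * (z *m z^T) 0 0.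
  by rewrite linearZ /= -scalemxAr mxE.
rewrite !sc !dt.
have : (x *m x^T) 0 0 + (y *m y^T) 0 0 = n%:R.
  rewrite !dot_sumE -big_split -(sum_cos2_sin2 n f) /=.
  by apply: eq_bigr => k _; rewrite !mxE !expr2.
set X := (x *m x^T) 0 0; set Y := (y *m y^T) 0 0 => XY h1 h2.
have -> : 2 * n%:R * s = 2 * (s * X) + 2 * (s * Y) by rewrite -XY; ring.
by rewrite mulrC; lra.
Qed.

(** Enlarging the square by one adds a border containing distance 0 once and each other distance
    twice. The result is a sum of partial sums, the form to which Cesaro's theorem applies. *)
Lemma double_sum_absdiff (phi : nat -> R) n :
  \sum_(j < n) \sum_(k < n) phi (absdiff j k) =
  \sum_(i < n) (phi 0%N + 2 * \sum_(l < i) phi l.+1).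
Proof.
elim: n => [|n IH]; first by rewrite !big_ord0.
rewrite [RHS]big_ord_recr /= -IH big_ord_recr /=.
under eq_bigr do rewrite big_ord_recr /=.
rewrite big_split /= -addrA; congr (_ + _).
rewrite big_ord_recr /= /absdiff distnn addrA addrC; congr (_ + _).
rewrite mulr_natl mulr2n; congr (_ + _).
  rewrite (reindex_inj rev_ord_inj) /=; apply: eq_bigr => l _; congr phi.
  by have := ltn_ord l; lia.
rewrite (reindex_inj rev_ord_inj) /=; apply: eq_bigr => l _; congr phi.
by have := ltn_ord l; lia.
Qed.

(** The double sum of a banded phi averages partial sums that are constant from m on. *)
Lemma cvg_mean_double_sum (phi : nat -> R) m :
  (forall l, (m < l)%N -> phi l = 0) ->
  (fun n => n.+1%:R^-1 * \sum_(j < n.+1) \sum_(k < n.+1) phi (absdiff j k))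
    @ \oo --> phi 0%N + 2 * \sum_(l < m) phi l.+1.
Proof.
move=> phi0; pose psi i := phi 0%N + 2 * \sum_(l < i) phi l.+1.
have -> : (fun n => n.+1%:R^-1 * \sum_(j < n.+1) \sum_(k < n.+1) phi (absdiff j k))
    = arithmetic_mean psi.
  apply/funext => n; rewrite double_sum_absdiff /arithmetic_mean /= /series /=.
  by rewrite big_mkord.
apply: cesaro; apply: cvg_near_cst; near=> i; rewrite /psi.
have mi : (m <= i)%N by near: i; exact: nbhs_infty_ge.
congr (_ + 2 * _); rewrite -(big_mkord predT (fun l => phi l.+1)).
rewrite (big_cat_nat _ mi)//= big_mkord [X in _ + X](_ : _ = 0) ?addr0//.
rewrite big_nat_cond big1// => l /andP[/andP[ml _] _].
by apply: phi0; rewrite ltnS.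
Unshelve. all: by end_near. Qed.

Lemma mean_trace_inv_cvg c : (forall n, possemidef (toeplitz n c)) ->
  cvgn (mean_trace_inv c).
Proof.
move=> pc; apply: ereal_nondecreasing_is_cvgn.
exact: nondecreasing_mean_trace_inv.
Qed.

Lemma limn_mean_trace_inv_ge n c (lam : 'I_n.+1 -> R) :
  (forall n, possemidef (toeplitz n c)) -> (forall f, 0 <= cos_poly lam f) ->
  ((2 * intI (fun f => Num.sqrt (cos_poly lam f)) - \sum_l lam l * c l)%:E <=
    limn (mean_trace_inv c))%E.
Proof.
move=> pc P0; set V := intI _; set L := limn _.
(* The double sum of phi is tr (C_k T_k(P)). Since P has degree n, phi vanishes beyond n, and for 0
   < l <= n it is lam_l c_l / 2, the half being restored by the two entries at distance l. *)
pose phi l := c l * intI (fun f => cosn l f * cos_poly lam f).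
have kap l : intI (fun f => cosn l f * cos_poly lam f) =
    \sum_i lam i * intI (fun f => cosn i f * cosn l f).
  rewrite -intI_cos_poly_mul; last exact: continuous_cosn.
  by apply: eq_intI => f; rewrite mulrC.
have phi_gt l : (n < l)%N -> phi l = 0.
  move=> nl; rewrite /phi kap big1 ?mulr0// => i _.
  rewrite intI_cosnM ifN ?mulr0//.
  by apply: contraTneq nl => <-; rewrite -leqNgt -ltnS.
have phi_sum : phi 0%N + 2 * \sum_(l < n) phi l.+1 = \sum_l lam l * c l.
  have phiE (l : 'I_n.+1) : phi l = (if l == 0%N :> nat then 1 else 2^-1) * (lam l * c l).
    rewrite /phi kap (bigD1 l)//= big1 ?addr0.
      rewrite intI_cosnM eqxx; case: (_ == 0%N); ring.
    move=> i il; rewrite intI_cosnM; case: (eqVneq (i : nat) l) => [/val_inj il'|_].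
      by rewrite il' eqxx in il.
    by rewrite mulr0.
  rewrite big_ord_recl [phi 0%N](phiE ord0) /= mul1r; congr (_ + _).
  rewrite mulr_sumr; apply: eq_bigr => l _.
  by rewrite [phi _](phiE (lift ord0 l)) /=; field.
have cM := mean_trace_inv_cvg pc.
have r_le k : ((2 * V - k.+1%:R^-1 *
    \sum_(j < k.+1) \sum_(i < k.+1) phi (absdiff j i))%:E <= L)%E.
  apply: (@le_trans _ _ (mean_trace_inv c k.+1)); last first.
    have /cvg_lim := ereal_nondecreasing_cvgn (nondecreasing_mean_trace_inv pc).
    by rewrite /L => -> //; apply: ereal_sup_ubound; exists k.+1.
  have [uT|uT] := boolP (toeplitz k.+1 c \in unitmx); last first.
    by rewrite (mean_trace_inv_singular (negbTE uT)) leey.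
  rewrite /mean_trace_inv /trace_inv uT -EFinM lee_fin [leRHS]mulrC ler_pdivlMr//.
  have := tr_invmx_ge (possemidef_unitmx (pc _) uT) (continuous_cos_poly (lam:=lam)) P0.
  apply: le_trans; rewrite mulrBl [X in _ - X]mulrC mulVKf ?pnatr_eq0//.
  by rewrite -/V mulrAC.
have cvr := cvg_mean_double_sum phi_gt; rewrite phi_sum in cvr.
case: L r_le => [l||] r_le; [|exact: leey|by have := r_le 0%N; rewrite leeNy_eq].
rewrite lee_fin.
have cr : (fun k => 2 * V - k.+1%:R^-1 *
    \sum_(j < k.+1) \sum_(i < k.+1) phi (absdiff j i)) @ \oo -->
    2 * V - \sum_l lam l * c l.
  by apply: cvgB => //; exact: cvg_cst.
rewrite -(cvg_lim _ cr)//; apply: limr_le; first by apply/cvg_ex; eexists; exact: cr.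
by apply: nearW => k; rewrite -lee_fin.
Qed.

(** * Covariances that are the moments of a density bounded away from zero *)

Section MomentsOfDensity.
Variables (S : R -> R) (c : nat -> R) (s : R).
Hypotheses (cS : continuous S) (s0 : 0 < s) (Ss : forall f, s <= S f).
Hypothesis cE : forall l, c l = intI (fun f => cosn l f * S f).

Lemma row_sqrE n (y : 'rV[R]_n) f :
  (\sum_k y 0 k * cosn k f) ^+ 2 + (\sum_k y 0 k * sinn k f) ^+ 2 =
  \sum_a \sum_b (y 0 a * y 0 b) * cosn (absdiff a b) f.
Proof.
rewrite !expr2 !mulr_suml -big_split; apply: eq_bigr => a _ /=.
rewrite !mulr_sumr -big_split; apply: eq_bigr => b _ /=.
by rewrite -cosn_sinnM; ring.
Qed.

Lemma qform_moments n (y : 'rV[R]_n) : qform (toeplitz n c) y =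
  intI (fun f => ((\sum_k y 0 k * cosn k f) ^+ 2 +
                  (\sum_k y 0 k * sinn k f) ^+ 2) * S f).
Proof.
rewrite qformE.
transitivity (\sum_a \sum_b (y 0 a * y 0 b) *
    intI (fun f => cosn (absdiff a b) f * S f)).
  apply: eq_bigr => a _; apply: eq_bigr => b _.
  by rewrite mxE cE mulrAC.
rewrite -(intI_double_sum (fun a b => y 0 a * y 0 b) cS).
by apply: eq_intI => f; rewrite row_sqrE.
Qed.

Lemma continuous_row_cos n (y : 'rV[R]_n) : continuous (fun f => \sum_k y 0 k * cosn k f).
Proof.
by apply: continuous_sumf => k _; apply: continuous_mulf;
  [exact: continuous_cstf|exact: continuous_cosn].
Qed.

Lemma continuous_row_sin n (y : 'rV[R]_n) : continuous (fun f => \sum_k y 0 k * sinn k f).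
Proof.
by apply: continuous_sumf => k _; apply: continuous_mulf;
  [exact: continuous_cstf|exact: continuous_sinn].
Qed.

Lemma continuous_row_sqr n (y : 'rV[R]_n) : continuous (fun f =>
  (\sum_k y 0 k * cosn k f) ^+ 2 + (\sum_k y 0 k * sinn k f) ^+ 2).
Proof.
apply: continuous_addf.
  by apply: continuous_mulf; exact: continuous_row_cos.
by apply: continuous_mulf; exact: continuous_row_sin.
Qed.

Lemma posdef_moments n : posdef (toeplitz n c).
Proof.
split; first exact: toeplitz_sym.
move=> y y0; rewrite -/(qform _ y) qform_moments.
have [k yk] : exists k, y 0 k != 0 by apply/rV0Pn.
apply: (@lt_le_trans _ _ (s * \sum_a y 0 a * y 0 a)).
  rewrite mulr_gt0// (bigD1 k)//= ltr_pwDl//.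
    by rewrite -expr2 lt_neqAle sqr_ge0 andbT eq_sym sqrf_eq0.
  by apply: sumr_ge0 => i _; rewrite -expr2 sqr_ge0.
rewrite -(intI_double_sum1 (fun a b => y 0 a * y 0 b)) -intIZ; last exact: continuous_double_sum.
apply: le_intI.
- by apply: continuous_mulf; [exact: continuous_cstf|exact: continuous_double_sum].
- by apply: continuous_mulf => //; exact: continuous_row_sqr.
by move=> f _; rewrite -row_sqrE mulrC ler_wpM2l// addr_ge0// sqr_ge0.
Qed.

(** For y = e_k T^-1 the diagonal entry is 2 y_k - y T y. With Y the trigonometric polynomial of
    coefficients y and e_k the exponential of index k, this is the integral of 2 Re (e_k conj Y) -
    |Y|^2 S, and completing the square at each frequency bounds it by \int 1/S. *)
Lemma invmx_moments_le n (k : 'I_n) :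
  invmx (toeplitz n c) k k <= intI (fun f => (S f)^-1).
Proof.
have S0 f : 0 < S f by exact: lt_le_trans (Ss f).
have cV : continuous (fun f => (S f)^-1).
  by apply: continuous_invf => // f; rewrite gt_eqF.
have uT := posdef_unitmx (posdef_moments n).
rewrite -qform_delta qform_invmx_eq ?toeplitz_sym//.
move: (_ *m invmx _) => y; rewrite qform_moments -rowE mxE.
(* Re (e_k conj Y), whose integral is y_k by orthogonality. *)
pose g f := cosn k f * (\sum_j y 0 j * cosn j f) + sinn k f * (\sum_j y 0 j * sinn j f).
have cg : continuous g.
  apply: continuous_addf; apply: continuous_mulf.
  - exact: continuous_cosn.
  - exact: continuous_row_cos.
  - exact: continuous_sinn.
  - exact: continuous_row_sin.
have -> : y^T k 0 = intI g.
  have := intI_double_sum1 (fun a b => (a == k)%:R * y 0 b).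
  rewrite (bigD1 k)//= eqxx mul1r big1 ?addr0; last by move=> a /negbTE ->; rewrite mul0r.
  rewrite mxE => <-; apply: eq_intI => f; rewrite (bigD1 k)//= [X in _ + X]big1 ?addr0; last first.
    by move=> a /negbTE ak; rewrite big1// => b _; rewrite ak !mul0r.
  rewrite /g !mulr_sumr -big_split; apply: eq_bigr => b _.
  by rewrite /= eqxx mul1r -cosn_sinnM; ring.
have cq : continuous (fun f => ((\sum_k y 0 k * cosn k f) ^+ 2 +
                  (\sum_k y 0 k * sinn k f) ^+ 2) * S f).
  by apply: continuous_mulf => //; exact: continuous_row_sqr.
rewrite -intIZ// -intIB//; last by apply: continuous_mulf => //; exact: continuous_cstf.
apply: le_intI => //.
  by apply: continuous_subf => //; apply: continuous_mulf => //; exact: continuous_cstf.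
move=> f _; rewrite /g; set a := \sum_j _; set b := \sum_j _.
rewrite -subr_ge0.
have -> : (S f)^-1 = (S f)^-1 * (cosn k f ^+ 2 + sinn k f ^+ 2).
  by rewrite cos2Dsin2 mulr1.
have -> : (S f)^-1 * (cosn k f ^+ 2 + sinn k f ^+ 2) -
    (2 * (cosn k f * a + sinn k f * b) - (a ^+ 2 + b ^+ 2) * S f) =
    (S f)^-1 * ((cosn k f - S f * a) ^+ 2 + (sinn k f - S f * b) ^+ 2).
  by field; rewrite gt_eqF.
by rewrite mulr_ge0 ?invr_ge0 ?(ltW (S0 f))// addr_ge0// sqr_ge0.
Qed.

Lemma limn_mean_trace_inv_le :
  (limn (mean_trace_inv c) <= (intI (fun f => (S f)^-1))%:E)%E.
Proof.
apply: lime_le.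
  by apply: mean_trace_inv_cvg => n; apply: posdef_possemidef; exact: posdef_moments.
apply: nearW => n; rewrite /mean_trace_inv /trace_inv (posdef_unitmx (posdef_moments n)).
rewrite -EFinM lee_fin; set V := intI _.
case: n => [|n].
  rewrite invr0 mul0r; apply: intI_ge0 => f; rewrite invr_ge0.
  by apply: le_trans (Ss f); exact: ltW.
rewrite mulrC ler_pdivrMr// mulr_natr -[X in _ <= _ *+ X]card_ord -sumr_const.
by apply: ler_sum => k _; exact: invmx_moments_le.
Qed.

End MomentsOfDensity.

End Bounds.

(** * A stationary process with a prescribed even density *)

Section HarmonicProcess.
Context {R : realType}.
Local Notation mu := (@lebesgue_measure R).

Lemma integral_shift_half (u : R -> R) : continuous u ->
  (\int[mu]_(w in `[0%R, 1%R]) (u (w - 2^-1))%:E =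
   \int[mu]_(w in `[(- 2^-1)%R, (2^-1)%R]) (u w)%:E)%E.
Proof.
move=> cu; pose F (w : R) : R := w - 2^-1.
have dF (x : R) : is_derive x 1 F 1.
  rewrite /F -[X in is_derive _ _ _ X]subr0; exact: is_deriveB.
have F1 : derive1 F = cst 1.
  by apply/funext => x; rewrite derive1E (@derive_val _ _ _ _ _ _ _ (dF x)).
have cF : continuous F by move=> x; apply: cvgB; [exact: cvg_id|exact: cvg_cst].
have -> : (- 2^-1)%R = F 0 by rewrite /F sub0r.
have -> : 2^-1%R = F 1 by rewrite /F {2}(splitr 1) mul1r addrK.
rewrite (@integration_by_substitution_increasing R F u 0 1)//=.
- by apply: eq_integral => x _; rewrite F1 !fctE mulr1 /F sub0r.
- by move=> x y _ _ xy; rewrite ltrD2r.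
- by move=> x _; rewrite F1; exact: cvg_cst.
- by rewrite F1; exact: is_cvg_cst.
- by rewrite F1; exact: is_cvg_cst.
- split.
  + by move=> x _; exact: (@ex_derive _ _ _ _ _ _ _ (dF x)).
  + by apply: cvg_at_right_filter; exact: cF.
  + by apply: cvg_at_left_filter; exact: cF.
- exact: continuous_subspaceT.
Qed.

Lemma ltN11 : (-1 : R) < 1. Proof. lra. Qed.

Definition unif : probability (measurableTypeR R) R := uniform_prob ltN11.

(** One uniform w on [-1, 1] carries both random choices: |w| - 1/2 is the frequency and the sign of
    w selects the branch, so no product space is needed. *)
Definition two_sided (u v : R -> R) (w : R) : R :=
  if 0 <= w then u (w - 2^-1) else v (- w - 2^-1).

Lemma measurable_two_sided (u v : R -> R) : continuous u -> continuous v ->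
  measurable_fun setT (two_sided u v).
Proof.
move=> cu cv; apply: measurable_fun_ifT.
- by apply: measurable_fun_ler => //; exact: measurable_id.
- apply: continuous_measurable_fun => x.
  apply: (@continuous_comp _ _ _ (fun w : R => w - 2^-1) u); last exact: cu.
  by apply: cvgB; [exact: cvg_id|exact: cvg_cst].
- apply: continuous_measurable_fun => x.
  apply: (@continuous_comp _ _ _ (fun w : R => - w - 2^-1) v); last exact: cv.
  by apply: cvgB; [apply: cvgN; exact: cvg_id|exact: cvg_cst].
Qed.

Lemma integral_two_sided (u v : R -> R) : continuous u -> continuous v ->
  mu.-integrable `[(-1)%R, 1%R] (EFin \o two_sided u v) ->
  (\int[mu]_(w in `[(-1)%R, 1%R]) (two_sided u v w)%:E =
   (intI u + intI v)%:E)%E.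
Proof.
move=> cu cv ig; have mg := measurable_two_sided cu cv.
rewrite (@itv_bndbnd_setU _ _ (BLeft (-1)) (BLeft 0) (BRight 1)) ?bnd_simp//; [|lra..].
rewrite integral_setU_EFin//=; last 2 first.
- exact: measurable_funTS.
- by apply/disj_setPS => x [] /=; rewrite !in_itv/= => /andP[_ /lt_geF ->].
rewrite addeC EFinD; congr (_ + _)%E.
  rewrite -intI_EFin// -integral_shift_half//; apply: eq_integral => w.
  by rewrite inE /= in_itv /= => /andP[w0 _]; rewrite /two_sided w0.
rewrite -intI_EFin// -integral_shift_half//.
transitivity (\int[mu]_(w in `[(-1)%R, 0%R[) ((fun w : R => v (w - 2^-1)) (- w))%:E)%E.
  apply: eq_integral => w.
  by rewrite inE /= in_itv /= => /andP[_ w0]; rewrite /two_sided leNgt w0.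
have cs : continuous (fun w : R => v (w - 2^-1)).
  move=> x; apply: (@continuous_comp _ _ _ (fun w : R => w - 2^-1) v); last exact: cv.
  by apply: cvgB; [exact: cvg_id|exact: cvg_cst].
have csN : continuous (fun w : R => v (- w - 2^-1)).
  move=> x; apply: (@continuous_comp _ _ _ (fun w : R => - w - 2^-1) v); last exact: cv.
  by apply: cvgB; [apply: cvgN; exact: cvg_id|exact: cvg_cst].
rewrite integral_itv_bndo_bndc; last first.
  apply/measurable_EFinP; apply: measurable_funTS.
  exact: continuous_measurable_fun.
have := @integration_by_substitution_oppr R (fun w : R => v (- w - 2^-1)) 0 1.
rewrite oppr0 => ->//; last exact: continuous_subspaceT.
by apply: eq_integral => w _ /=; rewrite opprK.
Qed.

Lemma expectation_unif (g : R -> R) : measurable_fun setT g ->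
  mu.-integrable `[(-1)%R, 1%R] (EFin \o g) ->
  ('E_unif[g] = (2^-1)%:E * \int[mu]_(w in `[(-1)%R, 1%R]) (g w)%:E)%E.
Proof.
move=> mg ig; rewrite unlock integralE.
have mg' : measurable_fun setT (fun w => (g w)%:E) by exact/measurable_EFinP.
rewrite !integral_uniform//; last 2 first.
- exact: measurable_funeneg.
- exact: measurable_funepos.
rewrite -muleBr//; last first.
  apply: fin_num_adde_defl; rewrite fin_numN.
  exact: (integrable_neg_fin_num _ ig).
by rewrite -integralE (_ : 1 - -1 = 2 :> R)//; lra.
Qed.

Lemma bounded_integrable (g : R -> R) M : measurable_fun setT g ->
  (forall w, `|g w| <= M) -> mu.-integrable `[(-1)%R, 1%R] (EFin \o g).
Proof.
move=> mg gM; apply: measurable_bounded_integrable => //.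
- by apply: compact_finite_measure; exact: segment_compact.
- exact: measurable_funTS.
- exists M; split; first exact: num_real.
  by move=> N MN w _; exact: le_trans (gM w) (ltW MN).
Qed.

Lemma expectation_two_sided (u v : R -> R) M : continuous u -> continuous v ->
  (forall w, `|u w| <= M) -> (forall w, `|v w| <= M) ->
  'E_unif[two_sided u v]%E = ((intI u + intI v) / 2)%:E.
Proof.
move=> cu cv uM vM; have mg := measurable_two_sided cu cv.
have ig : mu.-integrable `[(-1)%R, 1%R] (EFin \o two_sided u v).
  apply: (@bounded_integrable _ M) => // w.
  by rewrite /two_sided; case: ifP.
by rewrite expectation_unif// integral_two_sided// -EFinM mulrC.
Qed.

Lemma Lfun2_bounded (g : R -> R) M : measurable_fun setT g ->
  (forall w, `|g w| <= M) -> (g : measurableTypeR R -> R) \in Lfun unif 2%:E.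
Proof.
move=> mg gM; rewrite inE; apply/andP; split; rewrite inE//=.
rewrite /finite_norm unlock poweR_lty//.
have M0 : 0 <= M by exact: le_trans (gM 0).
apply: (@le_lt_trans _ _ (\int[unif]_w cst (M ^+ 2)%:E w)%E).
  apply: ge0_le_integral => //=.
  - apply/measurable_EFinP; apply: (measurableT_comp (measurable_powR 2)).
    exact: measurableT_comp.
  - by move=> w _; rewrite lee_fin powR_mulrn// lerXn2r ?nnegrE.
by rewrite integral_cst//= probability_setT mule1 ltry.
Qed.

Variables (S : R -> R) (B : R).
Hypotheses (cS : continuous S) (S0 : forall f, 0 <= S f) (SB : forall f, S f <= B).
Hypothesis evS : forall f, S (- f) = S f.

(** A cosine alone would leave a cosine of index k + l in the product of two samples. With cos + sin
    the k + l part is a sine, which integrates to 0 against the even S, and only k - l remains: this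
    is stationarity. *)
Definition amplitude (k : int) (f : R) : R :=
  Num.sqrt (S f) * (cos (2 * pi * k%:~R * f) + sin (2 * pi * k%:~R * f)).

Lemma continuous_amplitude k : continuous (amplitude k).
Proof.
apply: continuous_mulf; first exact: continuous_sqrtf.
apply: continuous_addf => x.
- apply: (@continuous_comp _ _ _ (fun x => 2 * pi * k%:~R * x) cos).
    exact: continuous_linear.
  exact: continuous_cos.
- apply: (@continuous_comp _ _ _ (fun x => 2 * pi * k%:~R * x) sin).
    exact: continuous_linear.
  exact: continuous_sin.
Qed.

Lemma amplitude_bound k f : `|amplitude k f| <= Num.sqrt B * 2.
Proof.
rewrite normrM ger0_norm ?sqrtr_ge0// ler_pM ?sqrtr_ge0//.
  by rewrite ler_wsqrtr.
rewrite (le_trans (ler_normD _ _))// [2]mulr2n lerD// ler_norml.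
  by rewrite cos_geN1 cos_le1.
by rewrite sin_geN1 sin_le1.
Qed.

Lemma amplitudeM k l f : amplitude k f * amplitude l f =
  S f * cos (2 * pi * (k - l)%:~R * f) + S f * sin (2 * pi * (k + l)%:~R * f).
Proof.
rewrite /amplitude mulrACA -expr2 sqr_sqrtr// -mulrDr; congr (_ * _).
rewrite intrB intrD.
rewrite (_ : 2 * pi * (k%:~R - l%:~R) * f =
  2 * pi * k%:~R * f - 2 * pi * l%:~R * f); last by ring.
rewrite (_ : 2 * pi * (k%:~R + l%:~R) * f =
  2 * pi * k%:~R * f + 2 * pi * l%:~R * f); last by ring.
by rewrite cosB sinD; ring.
Qed.

Lemma intI_amplitudeM k l : intI (fun f => amplitude k f * amplitude l f) =
  intI (fun f => cosn `|k - l|%N f * S f).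
Proof.
have cc : continuous (fun f => S f * cos (2 * pi * (k - l)%:~R * f)).
  apply: continuous_mulf => // x.
  apply: (@continuous_comp _ _ _ (fun x => 2 * pi * (k - l)%:~R * x) cos).
    exact: continuous_linear.
  exact: continuous_cos.
have cs : continuous (fun f => S f * sin (2 * pi * (k + l)%:~R * f)).
  apply: continuous_mulf => // x.
  apply: (@continuous_comp _ _ _ (fun x => 2 * pi * (k + l)%:~R * x) sin).
    exact: continuous_linear.
  exact: continuous_sin.
under eq_intI do rewrite amplitudeM.
rewrite intID// [X in _ + X]intI_odd//; last first.
  by move=> f; rewrite evS mulrN sinN mulrN.
rewrite addr0; apply: eq_intI => f; rewrite mulrC; congr (_ * _).
rewrite /cosn; have [kl|kl] := leP 0 (k - l).
  by rewrite -{1}(gez0_abs kl).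
have -> : (k - l)%:~R = - `|(k - l)%R|%N%:R :> R.
  by rewrite pmulrn (ltz0_abs kl) intrN opprK.
by rewrite mulrN mulNr cosN.
Qed.

Definition harmonic (k : int) : R -> R :=
  two_sided (amplitude k) (fun f => - amplitude k f).

Lemma measurable_harmonic k :
  measurable_fun [set: measurableTypeR R] (harmonic k : measurableTypeR R -> R).
Proof.
apply: measurable_two_sided; first exact: continuous_amplitude.
by move=> x; apply: cvgN; exact: continuous_amplitude.
Qed.

Definition harmonic_rv (k : int) : {RV unif >-> R} :=
  @mfun_Sub _ _ (measurableTypeR R) R _ (mem_set (measurable_harmonic k)).

Lemma harmonic_bound k w : `|harmonic k w| <= Num.sqrt B * 2.
Proof. by rewrite /harmonic /two_sided; case: ifP => _; rewrite ?normrN amplitude_bound. Qed.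

Lemma harmonic_L2 k : (harmonic k : measurableTypeR R -> R) \in Lfun unif 2%:E.
Proof.
by apply: (@Lfun2_bounded _ (Num.sqrt B * 2)); [exact: measurable_harmonic|exact: harmonic_bound].
Qed.

Lemma harmonic_mean0 k : 'E_unif[harmonic k]%E = 0%E.
Proof.
have cN : continuous (fun f => - amplitude k f).
  by move=> x; apply: cvgN; exact: continuous_amplitude.
rewrite (@expectation_two_sided _ _ (Num.sqrt B * 2))//.
- under [intI (fun f => - _)]eq_intI do rewrite -mulN1r.
  rewrite intIZ ?mulN1r ?subrr ?mul0r//; exact: continuous_amplitude.
- exact: continuous_amplitude.
- exact: amplitude_bound.
- by move=> w; rewrite normrN amplitude_bound.
Qed.

Lemma harmonic_cov k l :
  'E_unif[(harmonic k : measurableTypeR R -> R) * (harmonic l : measurableTypeR R -> R)]%E =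
  (intI (fun f => cosn `|k - l|%N f * S f))%:E.
Proof.
have -> : (harmonic k : measurableTypeR R -> R) * (harmonic l : measurableTypeR R -> R) =
    two_sided (fun f => amplitude k f * amplitude l f)
      (fun f => amplitude k f * amplitude l f).
  apply/funext => w; rewrite /harmonic /two_sided.
  by rewrite -[LHS]/(_ * _); case: ifP => _ //; rewrite mulrNN.
have cc : continuous (fun f => amplitude k f * amplitude l f).
  by apply: continuous_mulf; exact: continuous_amplitude.
have bb w : `|amplitude k w * amplitude l w| <= (Num.sqrt B * 2) * (Num.sqrt B * 2).
  by rewrite normrM ler_pM// amplitude_bound.
rewrite (@expectation_two_sided _ _ ((Num.sqrt B * 2) * (Num.sqrt B * 2)))//.
by rewrite intI_amplitudeM; congr EFin; field.
Qed.

Definition harmonic_process : wss_process R.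
Proof.
refine (@WssProcess R _ (measurableTypeR R) unif
  harmonic_rv harmonic_L2 harmonic_mean0 _).
abstract by move=> i l; rewrite !harmonic_cov addrAC subrr add0r subr0.
Defined.

Lemma autocov_harmonic l :
  autocov harmonic_process l = intI (fun f => cosn `|l|%N f * S f).
Proof.
by rewrite /autocov -[X in fine X]/('E_unif[_ * _])%E harmonic_cov subr0.
Qed.

End HarmonicProcess.

(** * Truncated binomial series of (1 - u)^(-1/2) *)

Section InverseSqrtSeries.
Context {R : realType}.

(** The Taylor coefficients binom(2k, k) / 4^k, given by their successive ratios. *)
Fixpoint isqrt_coef (k : nat) : R :=
  if k is k'.+1 then isqrt_coef k' * (2 * k'%:R + 1) / (2 * k'%:R + 2) else 1.

Lemma isqrt_coef_ge0 k : 0 <= isqrt_coef k.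
Proof.
elim: k => [|k IH] /=; first by [].
have h : 0 <= k%:R :> R by [].
by rewrite divr_ge0 ?mulr_ge0//; lra.
Qed.

Definition isqrt_poly K : {poly R} := \poly_(k < K.+1) isqrt_coef k.

Lemma isqrt_polyS K :
  isqrt_poly K.+1 = isqrt_poly K + isqrt_coef K.+1 *: 'X^(K.+1).
Proof. by rewrite /isqrt_poly !poly_def big_ord_recr. Qed.

(** The full series solves 2 (1 - u) y' = y; truncation leaves a defect in the top monomial only. *)
Lemma isqrt_poly_ode K : 2 *: ((1 - 'X) * (isqrt_poly K)^`()) - isqrt_poly K =
  (- ((2 * K%:R + 1) * isqrt_coef K)) *: ('X^K : {poly R}).
Proof.
elim: K => [|K IH].
  rewrite /isqrt_poly poly_def big_ord_recr big_ord0 /= add0r expr0.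
  by rewrite alg_polyC derivC mulr0 scaler0 sub0r mulr0 add0r mul1r scaleN1r.
rewrite isqrt_polyS.
have : (2 * K%:R + 1) * isqrt_coef K = (2 * K%:R + 2) * isqrt_coef K.+1.
  have k0 : 2 * K%:R + 2 != 0 :> R by rewrite gt_eqF// ltr_wpDl// mulr_ge0.
  by rewrite /= [RHS]mulrC divfK// mulrC.
move: (isqrt_coef K.+1) => y yx; rewrite yx in IH.
rewrite derivD derivZ derivXn mulrDr scalerDr opprD addrACA IH /=.
rewrite (_ : 'X^K *+ K.+1 = K.+1%:R * 'X^K :> {poly R}); last by rewrite mulr_natl.
rewrite exprS -!mul_polyC -!natr1.
rewrite !(rmorphN, rmorphM, rmorphD, rmorph_nat, rmorph1) /=; ring.
Qed.

(* [G = (1 - X) A^2] satisfies [G' = - c X^K A], so [1 - G] has nonnegative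
   coefficients, vanishes to order [K + 1] at [0], and equals [1] at [1]. *)
Lemma isqrt_poly_error K (u : R) : 0 <= u <= 1 ->
  0 <= 1 - (1 - u) * (isqrt_poly K).[u] ^+ 2 <= u ^+ K.+1.
Proof.
move=> /andP[u0 u1]; set A := isqrt_poly K.
pose H : {poly R} := 1 - (1 - 'X) * A ^+ 2.
have HE x : H.[x] = 1 - (1 - x) * A.[x] ^+ 2.
  by rewrite /H !(hornerD, hornerN, hornerM, hornerC, hornerX, horner_exp).
pose c := (2 * K%:R + 1) * isqrt_coef K.
have c0 : 0 <= c.
  have hK : 0 <= K%:R :> R by [].
  by rewrite mulr_ge0 ?isqrt_coef_ge0//; lra.
have dH : H^`() = c *: ('X^K * A).
  rewrite /H derivB derivM derivB derivX !derivC expr2 derivM !sub0r.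
  have := isqrt_poly_ode K; rewrite -/A -/c => h.
  transitivity (- (A * (2 *: ((1 - 'X) * A^`()) - A))).
    by rewrite scaler_nat; ring.
  by rewrite h scaleNr mulrN opprK mulrC -scalerAl.
have Hi i : H`_i.+1 *+ i.+1 = c * (if (i < K)%N then 0 else A`_(i - K)).
  by rewrite -coef_deriv dH coefZ coefXnM.
have A0 i : 0 <= A`_i by rewrite coef_poly; case: ifP => // _; exact: isqrt_coef_ge0.
have H00 : H`_0 = 0.
  rewrite -horner_coef0 HE subr0 mul1r horner_coef0 coef_poly /=.
  by rewrite expr1n subrr.
have Hge i : 0 <= H`_i.
  case: i => [|i]; first by rewrite H00.
  have : 0 <= H`_i.+1 *+ i.+1 by rewrite Hi mulr_ge0//; case: ifP.
  by rewrite pmulrn_lge0.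
have Hlow i : (i <= K)%N -> H`_i = 0.
  case: i => [|i iK]; first by rewrite H00.
  by apply/eqP; have := Hi i; rewrite iK mulr0 => /eqP; rewrite mulrn_eq0.
have H1 : H.[1] = 1 by rewrite HE subrr mul0r subr0.
rewrite -HE horner_coef sumr_ge0/=; last by move=> i _; rewrite mulr_ge0// exprn_ge0.
rewrite -[leRHS]mulr1 -H1 horner_coef mulr_sumr; apply: ler_sum => i _.
rewrite expr1n mulr1; have [iK|iK] := leqP i K; first by rewrite Hlow// mul0r mulr0.
by rewrite mulrC ler_wpM2r// ler_wiXn2l.
Qed.

End InverseSqrtSeries.

(** * Pointwise convergence of the Fourier series of the density *)

Section FourierPartialSums.
Context {R : realType}.

Definition fourier_sum N (g : R -> R) (f : R) : R :=
  intI g + 2 * \sum_(l < N) intI (fun x => cosn l.+1 x * g x) * cosn l.+1 f.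

Lemma fourier_sumB N g h f : continuous g -> continuous h ->
  fourier_sum N (fun x => g x - h x) f = fourier_sum N g f - fourier_sum N h f.
Proof.
move=> cg ch; rewrite /fourier_sum intIB// opprD addrACA -mulrBr; congr (_ + 2 * _).
rewrite -sumrB; apply: eq_bigr => l _; rewrite -mulrBl; congr (_ * _).
rewrite -intIB; last 2 first.
- by apply: continuous_mulf => //; exact: continuous_cosn.
- by apply: continuous_mulf => //; exact: continuous_cosn.
by apply: eq_intI => x; rewrite mulrBr.
Qed.

(** A crude bound on the Lebesgue constant, linear in N; geometric approximation can afford it. *)
Lemma fourier_sum_bound N g f M : continuous g -> (forall x, `|g x| <= M) ->
  `|fourier_sum N g f| <= (2 * N%:R + 1) * M.
Proof.
move=> cg gM; have M0 : 0 <= M by exact: le_trans (gM 0).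
have -> : (2 * N%:R + 1) * M = M + 2 * (N%:R * M) by ring.
rewrite (le_trans (ler_normD _ _))// lerD//; first exact: intI_norm_le.
rewrite normrM ger0_norm// ler_pM2l//.
apply: (le_trans (ler_norm_sum _ _ _)).
apply: (@le_trans _ _ (\sum_(l < N) M)); last by rewrite sumr_const card_ord mulr_natl.
apply: ler_sum => l _; rewrite normrM -[leRHS]mulr1 ler_pM// ?cosn_le1//.
apply: intI_norm_le; first by apply: continuous_mulf => //; exact: continuous_cosn.
by move=> x; rewrite normrM -[leRHS]mul1r ler_pM// cosn_le1.
Qed.

Lemma fourier_sum_cosn N l f : (l <= N)%N -> fourier_sum N (@cosn R l) f = cosn l f.
Proof.
rewrite /fourier_sum intI_cosn; case: l => [|l] lN.
  rewrite cosn0 big1 ?mulr0 ?addr0// => i _.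
  by rewrite intI_cosnM mul0r.
rewrite /= add0r (bigD1 (Ordinal lN))//= big1 ?addr0.
  by rewrite intI_cosnM eqxx mulrA divff ?mul1r.
by move=> i il; rewrite intI_cosnM ifN ?mul0r.
Qed.

Lemma fourier_sum_even_trig N g f : even_trig N.+1 g -> fourier_sum N g f = g f.
Proof.
case=> lam gE; have -> : g = cos_poly lam by apply/funext.
rewrite cos_poly_cosn; under eq_bigr => l _ do
  rewrite -(@fourier_sum_cosn N l f (ltn_ord l)).
have intP (h : R -> R) : continuous h -> intI (fun x => h x * cos_poly lam x) =
    \sum_l lam l * intI (fun x => h x * cosn l x).
  move=> ch; under eq_intI do rewrite mulrC.
  rewrite intI_cos_poly_mul//; apply: eq_bigr => l _; congr (_ * _).
  by apply: eq_intI => x; rewrite mulrC.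
rewrite /fourier_sum.
under [RHS]eq_bigr do rewrite mulrDr mulrCA.
rewrite big_split /=; congr (_ + _).
  have := intP _ (@continuous_cstf R R 1); under eq_intI do rewrite mul1r.
  move=> ->; apply: eq_bigr => l _; congr (_ * _).
  by apply: eq_intI => x; rewrite mul1r.
rewrite -mulr_sumr; congr (2 * _).
under [RHS]eq_bigr do rewrite mulr_sumr.
rewrite exchange_big /=; apply: eq_bigr => l _.
rewrite intP; last exact: continuous_cosn.
by rewrite mulr_suml; apply: eq_bigr => i _; rewrite mulrA.
Qed.

(** Folds the window of [has_psd], centred at index N, onto the distances to its centre. *)
Lemma sum_sym (h : nat -> R) N :
  \sum_(k < N.*2.+1) h (absdiff k N) = h 0%N + 2 * \sum_(l < N) h l.+1.
Proof.
have -> : N.*2.+1 = (N + N.+1)%N by rewrite addnS addnn.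
rewrite big_split_ord /= [X in _ + X]big_ord_recl /= /absdiff addn0 distnn.
rewrite addrCA; congr (_ + _); rewrite mulr_natl mulr2n; congr (_ + _).
  rewrite (reindex_inj rev_ord_inj) /=; apply: eq_bigr => l _; congr h.
  by have := ltn_ord l; lia.
by apply: eq_bigr => l _; congr h; rewrite /bump /= add1n; lia.
Qed.

(** Each of the first k powers of s is at least s^k, and together they stay below the full geometric
    series. *)
Lemma muln_geo_le (s : R) k : 0 <= s -> s < 1 -> k%:R * s ^+ k <= (1 - s)^-1.
Proof.
move=> s0 s1; have s1' : 0 < 1 - s by rewrite subr_gt0.
have h : k%:R * s ^+ k <= \sum_(i < k) s ^+ i.
  rewrite mulr_natl -[X in _ *+ X]card_ord -sumr_const; apply: ler_sum => i _.
  by rewrite ler_wiXn2l ?(ltW s1)// ltnW.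
apply: le_trans h _; rewrite -[leRHS]mul1r ler_pdivlMr//.
have := subrX1 s k; rewrite mulrC => h.
have -> : (\sum_(i < k) s ^+ i) * (1 - s) = 1 - s ^+ k.
  by rewrite -[1 - s]opprB mulrN -h opprB.
by rewrite lerBlDr lerDl exprn_ge0.
Qed.

Lemma continuous_psd_lam n (lam : 'I_n -> R) : (forall f, 0 < cos_poly lam f) ->
  continuous (psd_lam lam).
Proof.
move=> P0; apply: continuous_invf.
  by move=> f; rewrite gt_eqF// sqrtr_gt0.
by apply: continuous_sqrtf; exact: continuous_cos_poly.
Qed.

Lemma psd_approx n (lam : 'I_n.+1 -> R) : (forall f, 0 < cos_poly lam f) ->
  exists (C q : R), [/\ 0 <= C, 0 <= q < 1 & forall K, exists T : R -> R,
    [/\ even_trig (K * n).+1 T, continuous T &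
        forall f, `|psd_lam lam f - T f| <= C * q ^+ K.+1]].
Proof.
move=> P0; have [f0 _ fmin] := cos_poly_min lam.
(* a is the minimum of P and B dominates P, so u = 1 - P / B ranges in [0, 1 - a / B], which
   supplies the ratio q < 1. *)
set a := cos_poly lam f0 in fmin; pose B := \sum_l `|lam l|.
have a0 : 0 < a by exact: P0.
have PB f : cos_poly lam f <= B by exact: le_trans (ler_norm _) (cos_poly_le _ _).
have B0 : 0 < B by exact: lt_le_trans a0 (PB f0).
pose u f := 1 - B^-1 * cos_poly lam f.
have u01 f : 0 <= u f <= 1 - a / B.
  rewrite /u subr_ge0 mulrC ler_pdivrMr// mul1r PB /= lerD2l lerN2.
  by rewrite ler_pM2r ?invr_gt0.
exists (Num.sqrt a)^-1, (1 - a / B); split.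
- by rewrite invr_ge0 sqrtr_ge0.
- rewrite subr_ge0 ler_pdivrMr// mul1r PB /= ltrBlDr ltrDl divr_gt0//.
move=> K; exists (fun f => (Num.sqrt B)^-1 * (isqrt_poly K).[u f]); split.
- apply: even_trigZ.
  apply: (@eq_even_trig _ _ (fun f => \sum_(k < K.+1) isqrt_coef k * u f ^+ k)).
    by move=> f; rewrite horner_poly.
  have tu k : even_trig (k * n).+1 (fun f => u f ^+ k).
    elim: k => [|k IH].
      apply: (@eq_even_trig _ _ (@cosn R 0)); last exact: even_trig_cosn.
      by move=> f; rewrite expr0 cosn0.
    rewrite mulSn; apply: (@eq_even_trig _ _ (fun f => u f * u f ^+ k)).
      by move=> f; rewrite exprS.
    apply: even_trigM IH.
    apply: (@eq_even_trig _ _ (fun f => cosn 0 f + - B^-1 * cos_poly lam f)).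
      by move=> f; rewrite cosn0 mulNr.
    apply: even_trigD; first exact: even_trig_cosn.
    by apply: even_trigZ; exists lam.
  apply: even_trig_sum => k; apply: even_trigZ.
  have [lam' uE] := tu k.
  have kK : (k * n <= K * n)%N by rewrite leq_mul2r -ltnS ltn_ord orbT.
  apply: (@eq_even_trig _ _ (cos_poly lam')); first by move=> f; rewrite uE.
  apply: even_trig_sum => l; apply: even_trigZ; apply: even_trig_cosn.
  by apply: leq_trans (ltn_ord l) _.
- have cu : continuous u.
    apply: continuous_subf; first exact: continuous_cstf.
    by apply: continuous_mulf; [exact: continuous_cstf|exact: continuous_cos_poly].
  apply: continuous_mulf; first exact: continuous_cstf.
  move=> x; apply: (@continuous_comp _ _ _ u (horner (isqrt_poly K))); first exact: cu.
  exact: continuous_horner.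
move=> f; have /andP[uf0 ufq] := u01 f.
have uf1 : 0 <= u f <= 1.
  by rewrite uf0 (le_trans ufq)// lerBlDr lerDl divr_ge0// ltW.
have /andP[e0 e1] := isqrt_poly_error K uf1; set A := (isqrt_poly K).[u f] in e0 e1 *.
have A0 : 0 <= A.
  rewrite /A horner_poly sumr_ge0// => k _.
  by rewrite mulr_ge0 ?isqrt_coef_ge0// exprn_ge0.
have PE : cos_poly lam f = B * (1 - u f).
  by rewrite /u opprB addrC subrK mulrA divff ?mul1r// gt_eqF.
have w0 : 0 < 1 - u f by rewrite -(pmulr_rgt0 _ B0) -PE.
set w := Num.sqrt (1 - u f); have wp : 0 < w by rewrite sqrtr_gt0.
have w2 : w ^+ 2 = 1 - u f by rewrite sqr_sqrtr// ltW.
have sB : 0 < Num.sqrt B by rewrite sqrtr_gt0.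
(* With w = sqrt (1 - u) the error is S (1 - w A). Multiplying 1 - w A by 1 + w A >= 1 gives the
   polynomial error 1 - (1 - u) A^2 already bounded by u^(K+1). *)
have -> : psd_lam lam f - (Num.sqrt B)^-1 * A = (psd_lam lam f) * (1 - w * A).
  rewrite /psd_lam PE sqrtrM ?ltW// -/w; field.
  by rewrite !gt_eqF.
rewrite normrM ler_pM//.
  rewrite /psd_lam ger0_norm ?invr_ge0 ?sqrtr_ge0//.
  rewrite lef_pV2 ?posrE ?sqrtr_gt0//; exact: ler_wsqrtr.
have G : (1 - w * A) * (1 + w * A) = 1 - (1 - u f) * A ^+ 2 by rewrite -w2; ring.
have wA : 0 <= w * A by rewrite mulr_ge0// ltW.
apply: (@le_trans _ _ (u f ^+ K.+1)); last by rewrite lerXn2r// nnegrE// (le_trans uf0).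
apply: le_trans e1; rewrite -G ger0_norm.
  rewrite ler_peMr ?lerDl//.
  by rewrite -(@pmulr_lge0 _ (1 + w * A)) ?G// ltr_pwDl.
by rewrite -(@pmulr_lge0 _ (1 + w * A)) ?G// ltr_pwDl.
Qed.

Lemma fourier_sum_cvg n (lam : 'I_n.+1 -> R) f : (forall f, 0 < cos_poly lam f) ->
  (fun N => fourier_sum N (psd_lam lam) f) @ \oo --> psd_lam lam f.
Proof.
move=> P0; have [C [q [C0 /andP[q0 q1] app]]] := psd_approx P0.
have cS := continuous_psd_lam P0; set S := psd_lam lam in app cS *.
have err N : `|S f - fourier_sum N S f| <=
    C * n.+1%:R * 2 * ((N %/ n.+1).+1%:R * q ^+ (N %/ n.+1).+1).
  (* This K satisfies K n <= N, so the partial sum reproduces T, and N + 1 <= (K + 1) (n + 1), so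
     the linear loss in N is linear in K. Dividing by n + 1 also covers n = 0. *)
  set K := (N %/ n.+1)%N; have [T [tT cT TE]] := app K.
  have KN : (K * n <= N)%N.
    by apply: leq_trans (leq_trunc_div N n.+1); rewrite leq_mul2l leqnSn orbT.
  have tT' : even_trig N.+1 T.
    have [lam' TE'] := tT.
    apply: (@eq_even_trig _ _ (cos_poly lam')); first by move=> x; rewrite TE'.
    apply: even_trig_sum => l; apply: even_trigZ; apply: even_trig_cosn.
    by apply: leq_trans (ltn_ord l) _.
  have -> : S f - fourier_sum N S f =
      (S f - T f) - fourier_sum N (fun x => S x - T x) f.
    by rewrite fourier_sumB// (fourier_sum_even_trig _ tT'); ring.
  rewrite (le_trans (ler_normB _ _))//.
  apply: (@le_trans _ _ (C * q ^+ K.+1 + (2 * N%:R + 1) * (C * q ^+ K.+1))).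
    rewrite lerD//; apply: fourier_sum_bound => //; exact: continuous_subf.
  have Nn : N.+1%:R <= K.+1%:R * n.+1%:R :> R.
    by rewrite -natrM ler_nat mulSnr {1}(divn_eq N n.+1) -/K -addnS leq_add2l ltn_mod.
  have -> : C * q ^+ K.+1 + (2 * N%:R + 1) * (C * q ^+ K.+1) =
     2 * (C * q ^+ K.+1) * N.+1%:R by rewrite -natr1; ring.
  have -> : C * n.+1%:R * 2 * (K.+1%:R * q ^+ K.+1) =
     2 * (C * q ^+ K.+1) * (K.+1%:R * n.+1%:R) by ring.
  by rewrite ler_wpM2l// !mulr_ge0// exprn_ge0.
(* q^k = s^k s^k: one factor absorbs the linear growth, the other provides the decay. *)
pose s := Num.sqrt q; have s0 : 0 <= s by exact: sqrtr_ge0.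
have s1 : s < 1 by rewrite -[1]sqrtr1 ltr_sqrt.
have s2 : s ^+ 2 = q by rewrite sqr_sqrtr.
pose D := C * n.+1%:R * 2 * (1 - s)^-1.
have D0 : 0 <= D by rewrite !mulr_ge0// invr_ge0 subr_ge0 ltW.
have err2 N : `|S f - fourier_sum N S f| <= D * s ^+ (N %/ n.+1).+1.
  apply: le_trans (err N) _; rewrite /D -[leRHS]mulrA ler_wpM2l ?mulr_ge0//.
  rewrite -s2 -exprM mul2n -addnn exprD mulrA ler_wpM2r ?exprn_ge0//.
  exact: muln_geo_le.
apply/cvgrPdist_le => e e0.
have : D * s ^+ k @[k --> \oo] --> D * 0.
  by apply: cvgM; [exact: cvg_cst|apply: cvg_expr; rewrite ger0_norm].
rewrite mulr0 => /cvgrPdist_le/(_ e e0)[K _ KE].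
exists (K * n.+1)%N => // N /= KN; apply: le_trans (err2 N) _.
have := KE (N %/ n.+1).+1; rewrite /= sub0r normrN ger0_norm; last first.
  by rewrite mulr_ge0// exprn_ge0.
by apply; rewrite leqW// leq_divRL.
Qed.

End FourierPartialSums.


(** * From cosine partial sums to the two-sided complex series *)

Section PowerSpectralDensity.
Local Open Scope complex_scope.
Context {R : realType}.

Lemma cvg_complex_real (u : nat -> R) (l : R) : u @ \oo --> l ->
  (fun N => (u N)%:C : R[i]^o) @ \oo --> (l%:C : R[i]^o).
Proof.
(* In R[i] a positive epsilon has zero imaginary part, so it amounts to a real epsilon. *)
move=> ul; apply/cvgrPdist_lt => -[a b]; rewrite ltcE /= => /andP[/eqP b0 a0].
move/cvgrPdist_lt : ul => /(_ a a0)[K _ KE]; exists K => // N /= KN.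
have := KE N KN; rewrite -rmorphB normc_def /= expr0n addr0 sqrtr_sqr => h.
by rewrite ltcE /= b0 eqxx.
Qed.

Lemma has_psd_autocov (X : wss_process R) (S : R -> R) :
  (forall l, autocov X l = intI (fun f => cosn `|l|%N f * S f)) ->
  (forall f, (fun N => fourier_sum N S f) @ \oo --> S f) -> has_psd X S.
Proof.
move=> XE cvS f.
rewrite (_ : (fun N : nat => _) = (fun N => (fourier_sum N S f)%:C)); last first.
  apply/funext => N; apply/eqP; rewrite eq_complex Re_sum Im_sum /=.
  have cE k : autocov X ((k : nat)%:Z - N%:Z) =
      intI (fun x => cosn (absdiff k N) x * S x).
    by rewrite XE.
  apply/andP; split; apply/eqP.
    rewrite /fourier_sum.
    transitivity (\sum_(k < N.*2.+1) (fun d => intI (fun x => cosn d x * S x) * cosn d f)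
      (absdiff k N)).
      apply: eq_bigr => k _; rewrite mul0r subr0 cE; congr (_ * _).
      rewrite cosN cosn_absdiff; congr cos.
      by rewrite intrB -!pmulrn; ring.
    rewrite (sum_sym (fun d => intI (fun x => cosn d x * S x) * cosn d f)) /=.
    rewrite cosn0 mulr1; congr (_ + _); apply: eq_intI => x.
    by rewrite cosn0 mul1r.
  (* Reflecting the window negates each term, since the autocovariance is even and the sine odd. *)
  set s := \sum_(k < _) _; suff : s = - s by lra.
  rewrite {1}/s (reindex_inj rev_ord_inj) /= -sumrN; apply: eq_bigr => k _.
  have kN : (k <= N.*2)%N by rewrite -ltnS ltn_ord.
  have kE : (N.*2.+1 - k.+1)%:Z - N%:Z = - ((k : nat)%:Z - N%:Z).
    by rewrite subSS; lia.
  rewrite !mul0r !addr0 kE.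
  rewrite XE abszN -XE intrN !mulrN sinN !sinN; ring.
by apply: cvg_complex_real; exact: cvS.
Qed.

End PowerSpectralDensity.

(** * Existence of the coefficients by maximizing the dual function *)

Section DualProblem.
Context {R : realType}.
Local Notation mu := (@lebesgue_measure R).

Lemma sin_abs_le (x : R) : `|sin x| <= `|x|.
Proof.
wlog x0 : x / 0 <= x.
  move=> h; have [/h//|x0] := leP 0 x.
  by rewrite -normrN -sinN -[leRHS]normrN h// oppr_ge0 ltW.
have [->|xn0] := eqVneq x 0; first by rewrite sin0.
have x1 : 0 < x by rewrite lt_neqAle eq_sym xn0.
have [|c _] := @MVT R sin cos 0 x x1 (fun y _ => is_derive_sin y).
  by apply: continuous_subspaceT; exact: continuous_sin.
rewrite sin0 !subr0 => ->; rewrite normrM ler_piMl//.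
by rewrite ler_norml cos_geN1 cos_le1.
Qed.

Lemma one_sub_cos_le (x : R) : 1 - cos x <= x ^+ 2 / 2.
Proof.
have -> : x = (x / 2) *+ 2 by rewrite -mulr_natr divfK.
rewrite cos_mulr2n; have := cos2Dsin2 (x / 2); set s := sin _; set d := cos _ => h.
have : s ^+ 2 <= (x / 2) ^+ 2.
  by rewrite -[s ^+ 2]real_normK ?num_real// -[leRHS]real_normK ?num_real//
    lerXn2r ?nnegrE// sin_abs_le.
by rewrite (mulr2n (d ^+ 2)); lra.
Qed.

(** Adding the nonnegative value at the mirror point f0 - t turns P (f0 + t) into a second
    difference, so the first-order term cancels without any derivative of P. *)
Lemma cos_poly_zero_quadratic n (lam : 'I_n -> R) f0 :
  (forall f, 0 <= cos_poly lam f) -> cos_poly lam f0 = 0 ->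
  exists2 Q, 0 <= Q & forall t, cos_poly lam (f0 + t) <= Q * t ^+ 2.
Proof.
move=> P0 Pf0; exists (\sum_l `|lam l| * (2 * pi * l%:R) ^+ 2).
  by apply: sumr_ge0 => l _; rewrite mulr_ge0// sqr_ge0.
move=> t; apply: (@le_trans _ _ (cos_poly lam (f0 + t) + cos_poly lam (f0 - t)
  - 2 * cos_poly lam f0)).
  by rewrite Pf0 mulr0 subr0 lerDl.
rewrite !cos_poly_cosn mulr_sumr -big_split -sumrB /= mulr_suml.
apply: ler_sum => l _.
have -> : lam l * cosn l (f0 + t) + lam l * cosn l (f0 - t) - 2 * (lam l * cosn l f0) =
    (- (lam l * cosn l f0)) * (2 * (1 - cosn l t)).
  by rewrite /cosn mulrDr mulrBr cosD cosB; ring.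
apply: (le_trans (ler_norm _)); rewrite normrM normrN normrM -mulrA -[leRHS]mulrA ler_wpM2l//.
rewrite -[leRHS]mul1r ler_pM// ?cosn_le1//.
have := one_sub_cos_le (2 * pi * l%:R * t); rewrite -/(cosn l t) => h.
rewrite ger0_norm; first by move: h; rewrite exprMn; lra.
by rewrite mulr_ge0// subr_ge0 cos_le1.
Qed.

Lemma integral_inv_linear (q e f0 : R) : 0 < q -> 0 < e ->
  (\int[mu]_(x in `[f0, (f0 + 2^-1)%R]) ((q * (x - f0) + e)^-1)%:E =
   (q^-1 * (ln (q / 2 + e) - ln e))%:E)%E.
Proof.
move=> q0 e0; pose g (x : R) := q * (x - f0) + e.
pose F (x : R) := q^-1 * ln (g x).
have gpos x : x \in `[f0, f0 + 2^-1] -> 0 < g x.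
  by rewrite in_itv/= => /andP[h _]; rewrite ltr_wpDl// mulr_ge0 ?subr_ge0// ltW.
have cg : continuous g.
  move=> x; apply: cvgD; last exact: cvg_cst.
  by apply: cvgM; [exact: cvg_cst|apply: cvgB; [exact: cvg_id|exact: cvg_cst]].
have dg (x : R) : is_derive x 1 g q.
  have -> : q = q *: (1 - 0) + 0 by rewrite subr0 addr0 [q *: _]mulr1.
  have -> : g = (q \*: ((@id R) - cst f0)) + cst e by apply/funext => y.
  exact: is_deriveD.
have dF (x : R) : 0 < g x -> is_derive x 1 F (g x)^-1.
  move=> gx; have h := is_derive1_ln gx.
  have d2 : is_derive x 1 (@ln R \o g) ((g x)^-1 *: q) by exact: is_derive1_comp.
  have -> : (g x)^-1 = q^-1 *: ((g x)^-1 *: q).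
    by rewrite /GRing.scale /= mulrCA mulVf ?mulr1// gt_eqF.
  exact: is_deriveZ.
have cF x : x \in `[f0, f0 + 2^-1] -> {for x, continuous F}.
  move=> /gpos gx; apply: differentiable_continuous.
  by apply/derivable1_diffP; exact: (@ex_derive _ _ _ _ _ _ _ (dF x gx)).
have lr : f0 < f0 + 2^-1 by rewrite ltrDl.
rewrite (@continuous_FTC2 R (fun x => (g x)^-1) F)//.
- rewrite -EFinB /F /g subrr mulr0 add0r -mulrBr.
  by congr (_ * (ln _ - _))%:E; rewrite addrAC subrr add0r.
- apply: continuous_in_subspaceT => x /set_mem xin.
  by apply: cvgV; [rewrite gt_eqF// gpos|exact: cg].
- split.
  + move=> x xin; apply: (@ex_derive _ _ _ _ _ _ _ (dF x _)).
    by apply: gpos; exact: subset_itv_oo_cc.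
  + by apply: cvg_at_right_filter; apply: cF; rewrite in_itv/= lexx ltW.
  + by apply: cvg_at_left_filter; apply: cF; rewrite in_itv/= lexx ltW.
- move=> x xin; rewrite derive1E.
  have gx : 0 < g x by apply: gpos; exact: subset_itv_oo_cc.
  by rewrite (@derive_val _ _ _ _ _ _ _ (dF x gx)).
Qed.

(* [1 / sqrt P] is not integrable near a zero of a nonnegative [P], since that
   zero is at least double. *)
Lemma inv_sqrt_unbounded n (lam : 'I_n -> R) f0 (M : R) :
  (forall f, 0 <= cos_poly lam f) -> - 2^-1 <= f0 <= 0 -> cos_poly lam f0 = 0 ->
  exists2 e, 0 < e & M < intI (fun f => (Num.sqrt (cos_poly lam f + e))^-1).
Proof.
move=> P0 /andP[f01 f02] Pf0.
have [Q Q0 PQ] := cos_poly_zero_quadratic P0 Pf0.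
pose q := Num.sqrt Q + 1; have q0 : 0 < q by rewrite ltr_wpDl// sqrtr_ge0.
(* The shift is e^2, so that sqrt (P + e^2) <= q (f - f0) + e to the right of f0. The explicit
   integral is then at least ln (q / (2 e)) / q, and e is solved from ln (q / (2 e)) = q M + 1. *)
pose e := q / 2 / expR (q * M + 1).
have e0 : 0 < e by rewrite !divr_gt0// expR_gt0.
exists (e ^+ 2); first by rewrite exprn_gt0.
have Pe f : 0 < cos_poly lam f + e ^+ 2 by rewrite ltr_wpDl// exprn_gt0.
have cI : continuous (fun f => (Num.sqrt (cos_poly lam f + e ^+ 2))^-1).
  apply: continuous_invf; first by move=> f; rewrite gt_eqF// sqrtr_gt0.
  apply: continuous_sqrtf; apply: continuous_addf; first exact: continuous_cos_poly.
  exact: continuous_cstf.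
apply: (@lt_le_trans _ _ (q^-1 * (ln (q / 2 + e) - ln e))).
  rewrite mulrC ltr_pdivlMr// mulrC.
  apply: (@lt_le_trans _ _ (q * M + 1)); first by rewrite ltrDl.
  have qe0 : 0 < q / 2 + e by apply: addr_gt0 => //; apply: divr_gt0.
  have ex0 : 0 < expR (q * M + 1) by exact: expR_gt0.
  rewrite -ln_div ?posrE// -[leLHS]expRK ler_ln ?posrE//; last exact: divr_gt0.
  rewrite ler_pdivlMr// {1}/e mulrC divfK ?gt_eqF//.
  by rewrite lerDl ltW.
rewrite -lee_fin -(integral_inv_linear f0 q0 e0) -intI_EFin//.
have ifI : mu.-integrable `[(- 2^-1)%R, (2^-1)%R]
    (EFin \o (fun f => (Num.sqrt (cos_poly lam f + e ^+ 2))^-1)).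
  exact: continuous_integrable.
have sub : (`[f0, f0 + 2^-1] : set R) `<=` (`[- 2^-1, 2^-1] : set R).
  by move=> x /=; rewrite !in_itv/= => /andP[h1 h2]; apply/andP; split; lra.
apply: (@le_trans _ _ (\int[mu]_(x in `[f0, (f0 + 2^-1)%R])
    ((Num.sqrt (cos_poly lam x + e ^+ 2))^-1)%:E)%E); last first.
  apply: ge0_subset_integral => //=.
  by apply/measurable_EFinP; apply: measurable_funTS; exact: continuous_measurable_fun.
have mlin : measurable_fun `[f0, f0 + 2^-1]%classic
    (fun x : R => (q * (x - f0) + e)^-1).
  apply: subspace_continuous_measurable_fun => //.
  apply: continuous_in_subspaceT => x /set_mem /=; rewrite in_itv/= => /andP[h1 h2].
  apply: cvgV; first by rewrite gt_eqF// ltr_wpDl// mulr_ge0 ?subr_ge0// ltW.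
  apply: cvgD; last exact: cvg_cst.
  by apply: cvgM; [exact: cvg_cst|apply: cvgB; [exact: cvg_id|exact: cvg_cst]].
apply: ge0_le_integral => //=.
- move=> x; rewrite in_itv/= => /andP[h1 _]; rewrite lee_fin invr_ge0.
  by rewrite addr_ge0 ?(ltW e0)// mulr_ge0 ?subr_ge0// ltW.
- exact/measurable_EFinP.
- by apply/measurable_EFinP; apply: measurable_funTS; exact: continuous_measurable_fun.
move=> x; rewrite in_itv/= => /andP[h1 _].
have xf : 0 <= x - f0 by rewrite subr_ge0.
have lin0 : 0 < q * (x - f0) + e by rewrite ltr_wpDl// mulr_ge0// ltW.
rewrite lee_fin lef_pV2 ?posrE ?sqrtr_gt0//.
rewrite -[leRHS]ger0_norm ?(ltW lin0)// -sqrtr_sqr ler_wsqrtr//.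
have := PQ (x - f0); rewrite addrC subrK => h.
have sQ : Num.sqrt Q ^+ 2 = Q by rewrite sqr_sqrtr.
have sQ0 := sqrtr_ge0 Q.
rewrite sqrrD; apply: (@le_trans _ _ (q ^+ 2 * (x - f0) ^+ 2 + e ^+ 2)).
  rewrite lerD2r (le_trans h)// ler_wpM2r ?sqr_ge0// /q sqrrD sQ expr1n.
  by rewrite mulr1 (mulr2n (Num.sqrt Q)); lra.
rewrite [(q * (x - f0)) ^+ 2]exprMn -addrA lerD2l lerDr mulrn_wge0// !mulr_ge0//; exact: ltW.
Qed.

Variables (n : nat) (c : nat -> R).
Hypothesis pT : posdef (toeplitz n.+1 c).

Definition dual (lam : 'I_n.+1 -> R) : R :=
  2 * intI (fun f => Num.sqrt (cos_poly lam f)) - \sum_l lam l * c l.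

Lemma continuous_sqrt_cos_poly m (lam : 'I_m -> R) :
  continuous (fun f => Num.sqrt (cos_poly lam f)).
Proof. by apply: continuous_sqrtf; exact: continuous_cos_poly. Qed.

(** This covers negative arguments, where [Num.sqrt] is 0, so [dual] is continuous on the whole
    space, including across the boundary of the cone. *)
Lemma sqrt_dist_le (a b : R) : `|Num.sqrt a - Num.sqrt b| <= Num.sqrt `|a - b|.
Proof.
wlog ab : a b / b <= a.
  move=> h; have [/h//|/ltW/h] := leP b a.
  by rewrite distrC [`|b - a|]distrC.
rewrite !ger0_norm ?subr_ge0 ?ler_wsqrtr//.
have [b0|b0] := leP b 0.
  rewrite (ler0_sqrtr b0) subr0 ler_wsqrtr// lerDl oppr_ge0//.
have a0 : 0 <= a by rewrite (le_trans (ltW b0)).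
rewrite lerBlDr -[leRHS]ger0_norm ?addr_ge0 ?sqrtr_ge0// -sqrtr_sqr ler_wsqrtr//.
rewrite sqrrD !sqr_sqrtr ?subr_ge0 ?(ltW b0)//.
rewrite addrAC subrK lerDl mulrn_wge0// mulr_ge0// sqrtr_ge0.
Qed.

Lemma intI_sqrt_dist (lam nu : 'I_n.+1 -> R) :
  `|intI (fun f => Num.sqrt (cos_poly lam f)) -
    intI (fun f => Num.sqrt (cos_poly nu f))| <=
  Num.sqrt (\sum_l `|lam l - nu l|).
Proof.
have c1 := continuous_sqrt_cos_poly (lam:=lam).
have c2 := continuous_sqrt_cos_poly (lam:=nu).
rewrite -intIB//; apply: intI_norm_le; first exact: continuous_subf.
move=> f; apply: (le_trans (sqrt_dist_le _ _)); rewrite ler_wsqrtr//.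
rewrite !cos_poly_cosn -sumrB; apply: (le_trans (ler_norm_sum _ _ _)).
by apply: ler_sum => l _; rewrite -mulrBl normrM ler_piMr// cosn_le1.
Qed.

Lemma continuous_rV_sum (g : 'I_n.+1 -> R -> R) : (forall l, continuous (g l)) ->
  continuous (fun v : 'rV[R]_n.+1 => \sum_l g l (v 0 l)).
Proof.
move=> cg; apply: continuous_sumf => l _ v.
apply: (@continuous_comp _ _ _ (fun v : 'rV[R]_n.+1 => v 0 l) (g l)).
  exact: coord_continuous.
exact: cg.
Qed.

Lemma continuous_intI_sqrt :
  continuous (fun v : 'rV[R]_n.+1 => intI (fun f => Num.sqrt (cos_poly (v 0) f))).
Proof.
move=> v.
have h : continuous (fun w : 'rV[R]_n.+1 => Num.sqrt (\sum_l `|v 0 l - w 0 l|)).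
  move=> w; apply: (@continuous_comp _ _ _
      (fun w : 'rV[R]_n.+1 => \sum_l `|v 0 l - w 0 l|) Num.sqrt).
    apply: (@continuous_rV_sum (fun l x => `|v 0 l - x|)) => l x /=.
    by apply: cvg_norm; apply: cvgB; [exact: cvg_cst|exact: cvg_id].
  exact: sqrt_continuous.
apply/(@cvgrPdist_le _ _ _ (nbhs v)) => e e0.
have /(@cvgrPdist_le _ _ _ (nbhs v))/(_ e e0) := h v.
apply: (@filterS _ (nbhs v)) => w.
rewrite big1 ?sqrtr0; last by move=> l _; rewrite subrr normr0.
rewrite sub0r normrN ger0_norm ?sqrtr_ge0//; apply: le_trans.
exact: intI_sqrt_dist.
Qed.

Lemma continuous_dual : continuous (fun v : 'rV[R]_n.+1 => dual (v 0)).
Proof.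
apply: continuous_subf.
  by apply: continuous_mulf; [exact: continuous_cstf|exact: continuous_intI_sqrt].
apply: (@continuous_rV_sum (fun l x => x * c l)) => l.
by apply: (@continuous_mulf _ _ id) => [x|]; [exact: cvg_id|exact: continuous_cstf].
Qed.

(** For P >= 0 each cosine moment is at most \int P = lam_0 in absolute value; the 2 comes from \int
    cos^2 = 1/2. Bounding lam_0 alone therefore bounds a slice of the cone. *)
Lemma cos_poly_coef_bound (lam : 'I_n.+1 -> R) l : (forall f, 0 <= cos_poly lam f) ->
  `|lam l| <= 2 * lam ord0.
Proof.
move=> P0; have cP := continuous_cos_poly (lam:=lam).
have lam0 : 0 <= lam ord0 by rewrite -intI_cos_poly intI_ge0.
have : `|intI (fun f => cos_poly lam f * cosn l f)| <= lam ord0.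
  have cPc : continuous (fun f => cos_poly lam f * cosn l f).
    by apply: continuous_mulf => //; exact: continuous_cosn.
  have cc (f : R) : `|cosn l f| <= 1 by exact: cosn_le1.
  rewrite -intI_cos_poly ler_norml -mulN1r -intIZ//; apply/andP; split.
    apply: le_intI => //; first by apply: continuous_mulf => //; exact: continuous_cstf.
    move=> f _; rewrite mulN1r -mulrN1 ler_wpM2l//.
    by have := cc f; rewrite ler_norml => /andP[].
  apply: le_intI => // f _; rewrite ler_piMr//.
  by have := cc f; rewrite ler_norml => /andP[].
rewrite intI_cos_poly_mul; last exact: continuous_cosn.
rewrite (bigD1 l)//= big1 ?addr0; last first.
  move=> i il; rewrite intI_cosnM; case: (eqVneq (i : nat) l) => [/val_inj ile|_].
    by rewrite ile eqxx in il.
  by rewrite mulr0.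
rewrite intI_cosnM eqxx; case: ifP => _; rewrite ?mulr1 ?normrM => h.
  by rewrite (le_trans h)// mulr_natl mulr2n lerDl.
by move: h; rewrite [`|2^-1|]ger0_norm//; lra.
Qed.

Definition tau : R := \tr (invmx (toeplitz n.+1 c)).

(** If tau were 0, coercivity at P = 1 would read 1 <= 0. *)
Lemma tau_gt0 : 0 < tau.
Proof.
have t0 : 0 <= tau by apply: sumr_ge0 => k _; exact: invmx_diag_ge0.
rewrite lt_neqAle t0 andbT eq_sym; apply/eqP => tz.
have := @coercive _ n c (shift_coef (fun=> 0) 1) pT.
rewrite -/tau tz mul0r /shift_coef /= add0r => h.
suff : (1 : R) <= 0 by lra.
apply: h => f; rewrite cos_poly_shift cos_poly_cosn big1 ?add0r// => l _.
by rewrite mul0r.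
Qed.

(** 2 \int sqrt P <= 2 sqrt lam_0, while coercivity gives sum_l lam_l c_l >= lam_0 / tau. The second
    dominates as soon as sqrt lam_0 >= 2 tau, hence the threshold. *)
Lemma dual_le (lam : 'I_n.+1 -> R) : (forall f, 0 <= cos_poly lam f) ->
  4 * tau ^+ 2 < lam ord0 -> dual lam <= 0.
Proof.
move=> P0 big; have t0 := tau_gt0.
have l0 : 0 < lam ord0 by apply: le_lt_trans big; rewrite mulr_ge0// sqr_ge0.
pose s := Num.sqrt (lam ord0); have s0 : 0 < s by rewrite sqrtr_gt0.
have s2 : s ^+ 2 = lam ord0 by rewrite sqr_sqrtr// ltW.
have Is : intI (fun f => Num.sqrt (cos_poly lam f)) <= s.
  (* Jensen's inequality through the tangent of the square root at lam_0, the mean of P. *)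
  apply: (@le_trans _ _ (intI (fun f => (2 * s)^-1 * cos_poly lam f + s / 2))).
    apply: le_intI.
    - exact: continuous_sqrt_cos_poly.
    - apply: continuous_addf; last exact: continuous_cstf.
      by apply: continuous_mulf; [exact: continuous_cstf|exact: continuous_cos_poly].
    move=> f _; set r := Num.sqrt _.
    have <- : r ^+ 2 = cos_poly lam f by rewrite sqr_sqrtr.
    rewrite -subr_ge0.
    have -> : (2 * s)^-1 * r ^+ 2 + s / 2 - r = (2 * s)^-1 * (r - s) ^+ 2.
      by field; rewrite gt_eqF.
    by rewrite mulr_ge0 ?sqr_ge0// invr_ge0 mulr_ge0// ltW.
  rewrite intID; last 2 first.
  - by apply: continuous_mulf; [exact: continuous_cstf|exact: continuous_cos_poly].
  - exact: continuous_cstf.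
  rewrite intIZ; last exact: continuous_cos_poly.
  rewrite intI_cst intI_cos_poly -s2 le_eqVlt; apply/orP; left; apply/eqP.
  by field; rewrite gt_eqF.
have co := coercive pT P0; rewrite -/tau -s2 in co.
have ts : 2 * tau <= s.
  rewrite -[leLHS]ger0_norm ?mulr_ge0 ?(ltW t0)// -sqrtr_sqr ler_wsqrtr//.
  by rewrite exprMn (le_trans _ (ltW big))// -natrX.
rewrite /dual subr_le0; set L := \sum_l _ in co *.
rewrite -(ler_pM2l t0) (le_trans _ co)// (@le_trans _ _ (tau * (2 * s)))//.
  by rewrite ler_pM2l// ler_pM2l.
by rewrite mulrA [tau * 2]mulrC expr2 ler_pM2r.
Qed.

Lemma dual0 : dual (fun=> 0) = 0.
Proof.
rewrite /dual [X in _ - X]big1 ?subr0; last by move=> l _; rewrite mul0r.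
rewrite (@eq_intI _ _ (fun=> 0)) ?intI_cst ?mulr0// => f.
by rewrite cos_poly_cosn big1 ?sqrtr0// => l _; rewrite mul0r.
Qed.

Lemma cos_poly0 m f : cos_poly (fun _ : 'I_m => 0 : R) f = 0.
Proof. by rewrite cos_poly_cosn big1// => l _; rewrite mul0r. Qed.

Lemma dual_max : exists2 lam : 'I_n.+1 -> R, (forall f, 0 <= cos_poly lam f) &
  forall nu, (forall f, 0 <= cos_poly nu f) -> dual nu <= dual lam.
Proof.
pose b := 4 * tau ^+ 2; have b0 : 0 <= b by rewrite mulr_ge0// sqr_ge0.
(* The search is confined to this compact slice: outside it [dual] is at most 0, a value attained
   inside at the origin. *)
pose A := [set v : 'rV[R]_n.+1 | (forall f, 0 <= cos_poly (v 0) f) /\ v 0 ord0 <= b].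
have cA : compact A.
  have cB : compact [set v : 'rV[R]_n.+1 | forall i, `[- (2 * b), 2 * b]%classic (v ord0 i)].
    by apply: (@rV_compact R _ (fun=> `[- (2 * b), 2 * b]%classic)) => i; exact: segment_compact.
  apply: subclosed_compact cB _; last first.
    move=> v [P0 vb] i /=; rewrite in_itv /= -ler_norml.
    by rewrite (le_trans (cos_poly_coef_bound i P0))// ler_pM2l.
  have -> : A = (\bigcap_(f in [set: R]) ((fun v : 'rV[R]_n.+1 => cos_poly (v 0) f)
      @^-1` [set x | 0 <= x])) `&` ((fun v : 'rV[R]_n.+1 => v 0 ord0) @^-1` [set x | x <= b]).
    apply/seteqP; split => v [h1 h2]; split => //.
    - by move=> f _; exact: h1.
    - by move=> f; exact: h1.
  apply: closedI.
    apply: closed_bigI => f _; apply: preimage_closed; last exact: closed_ge.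
    move=> v _; apply: (@continuous_rV_sum (fun l x => x * cosn l f)) => l.
    by apply: (@continuous_mulf _ _ id) => [x|]; [exact: cvg_id|exact: continuous_cstf].
  apply: preimage_closed; last exact: closed_le.
  by move=> v _; exact: coord_continuous.
have A0 : A !=set0.
  exists 0; split; last by rewrite mxE.
  move=> f; rewrite cos_poly_cosn big1// => l _; by rewrite mxE mul0r.
have [|v /set_mem[P0 vb] vmax] := @compact_EVT_max _ R (fun v : 'rV[R]_n.+1 => dual (v 0)) A A0 cA.
  by apply: continuous_subspaceT; exact: continuous_dual.
have maxA nu : (forall f, 0 <= cos_poly nu f) -> nu ord0 <= b -> dual nu <= dual (v 0).
  move=> N0 nb; have nuE : (\row_l nu l) 0 = nu by apply/funext => l; rewrite mxE.
  by have := vmax (\row_l nu l); rewrite nuE; apply; apply/mem_set; split; rewrite ?nuE.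
exists (v 0) => // nu N0; have [|nb] := leP (nu ord0) b; first exact: maxA.
rewrite (le_trans (dual_le N0 nb))// -dual0; apply: maxA => // f.
by rewrite cos_poly0.
Qed.

(** If P vanished somewhere, raising it by a small constant e would cost e c_0 and gain at least e
    \int 1/sqrt(P + e). Some e makes that integral exceed c_0, contradicting maximality. *)
Lemma dual_max_pos (lam : 'I_n.+1 -> R) : (forall f, 0 <= cos_poly lam f) ->
  (forall nu, (forall f, 0 <= cos_poly nu f) -> dual nu <= dual lam) ->
  forall f, 0 < cos_poly lam f.
Proof.
move=> P0 lmax f; have [f0 f01 fmin] := cos_poly_min lam.
apply: lt_le_trans (fmin f); rewrite lt_neqAle P0 andbT eq_sym; apply/eqP => Pf0.
have [e e0] := inv_sqrt_unbounded (c 0%N) P0 f01 Pf0; apply/negP; rewrite -leNgt.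
have Ne g : 0 < cos_poly lam g + e by rewrite ltr_wpDl.
have := lmax (shift_coef lam e); rewrite {1}/dual shift_coef_sum /dual => h.
have {}h : 2 * intI (fun g => Num.sqrt (cos_poly lam g + e)) -
    (\sum_l lam l * c l + e * c 0%N) <=
    2 * intI (fun g => Num.sqrt (cos_poly lam g)) - \sum_l lam l * c l.
  rewrite (@eq_intI _ _ (fun g => Num.sqrt (cos_poly (shift_coef lam e) g))).
    by apply: h => g; rewrite cos_poly_shift ltW.
  by move=> g; rewrite cos_poly_shift.
have cse : continuous (fun g => Num.sqrt (cos_poly lam g + e)).
  apply: continuous_sqrtf; apply: continuous_addf; first exact: continuous_cos_poly.
  exact: continuous_cstf.
have cs := continuous_sqrt_cos_poly (lam:=lam).
have cI : continuous (fun g => (Num.sqrt (cos_poly lam g + e))^-1).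
  by apply: continuous_invf => // g; rewrite gt_eqF// sqrtr_gt0.
(* Concavity of the square root, with the slope taken at the upper end, where P + e > 0. *)
have : e / 2 * intI (fun g => (Num.sqrt (cos_poly lam g + e))^-1) <=
    intI (fun g => Num.sqrt (cos_poly lam g + e)) - intI (fun g => Num.sqrt (cos_poly lam g)).
  rewrite -intIZ// -intIB//; apply: le_intI.
  - by apply: continuous_mulf => //; exact: continuous_cstf.
  - exact: continuous_subf.
  move=> g _; set r := Num.sqrt (_ + e); set s := Num.sqrt _.
  have r0 : 0 < r by rewrite sqrtr_gt0.
  have r2 : r ^+ 2 = cos_poly lam g + e by rewrite sqr_sqrtr// ltW.
  have s2 : s ^+ 2 = cos_poly lam g by rewrite sqr_sqrtr.
  have -> : e = r ^+ 2 - s ^+ 2 by rewrite r2 s2; ring.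
  rewrite -subr_ge0.
  have -> : r - s - (r ^+ 2 - s ^+ 2) / 2 / r = (r - s) ^+ 2 / 2 / r.
    by field; rewrite gt_eqF.
  by rewrite !divr_ge0 ?sqr_ge0// ltW.
set J := intI (fun g => (_)^-1) => h2.
have : e * (J - c 0%N) <= 0 by move: h h2; nra.
by rewrite pmulr_rle0// subr_le0.
Qed.

(** A quadratic minorant of the square root valid for every b >= 0; the gap factors as (r - s)^2 r
    (r + 2 s) / (2 s^3). It yields first-order conditions without differentiating under the
    integral. *)
Lemma sqrt_taylor (a b : R) : 0 < a -> 0 <= b ->
  Num.sqrt a + (b - a) / (2 * Num.sqrt a) - (b - a) ^+ 2 / (2 * Num.sqrt a ^+ 3)
    <= Num.sqrt b.
Proof.
move=> a0 b0; set s := Num.sqrt a; set r := Num.sqrt b.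
have s0 : 0 < s by rewrite sqrtr_gt0.
have r0 : 0 <= r by exact: sqrtr_ge0.
have -> : a = s ^+ 2 by rewrite sqr_sqrtr// ltW.
have -> : b = r ^+ 2 by rewrite sqr_sqrtr.
rewrite -subr_ge0.
have -> : r - (s + (r ^+ 2 - s ^+ 2) / (2 * s) - (r ^+ 2 - s ^+ 2) ^+ 2 / (2 * s ^+ 3)) =
   (r - s) ^+ 2 * (r * (r + 2 * s)) / (2 * s ^+ 3).
  by field; rewrite gt_eqF.
have s2 : 0 <= 2 * s by rewrite mulr_ge0// ltW.
have s3 : 0 <= 2 * s ^+ 3 by rewrite mulr_ge0// exprn_ge0// ltW.
apply: divr_ge0 => //; apply: mulr_ge0; first exact: sqr_ge0.
by apply: mulr_ge0 => //; exact: addr_ge0.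
Qed.

Lemma linear_le_quadratic (d K a : R) : 0 < a ->
  (forall t, `|t| <= a -> t * d <= K * t ^+ 2) -> d = 0.
Proof.
move=> a0 h; apply/eqP; apply: contraT => d0.
have nd : 0 < `|d| by rewrite normr_gt0.
(* The test point is t = r d: the first bound keeps |t| <= a, the second gives K r < 1. *)
pose r := Num.min (a / `|d|) (2 * (`|K| + 1))^-1.
have K1 : 0 < 2 * (`|K| + 1) by rewrite mulr_gt0// ltr_wpDl.
have r0 : 0 < r by rewrite lt_min divr_gt0// invr_gt0.
have ra : `|r * d| <= a.
  by rewrite normrM gtr0_norm// -ler_pdivlMr// ge_min lexx.
have := h _ ra; rewrite exprMn.
have -> : r * d * d = r * d ^+ 2 by rewrite expr2 mulrA.
have -> : K * (r ^+ 2 * d ^+ 2) = (r * d ^+ 2) * (K * r) by ring.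
have p0 : 0 < r * d ^+ 2 by rewrite mulr_gt0// lt_neqAle sqr_ge0 andbT eq_sym sqrf_eq0.
rewrite -{1}[r * d ^+ 2]mulr1 ler_pM2l//.
suff : K * r < 1 by move=> h1 h2; have := le_lt_trans h2 h1; rewrite ltxx.
apply: (@le_lt_trans _ _ (`|K| * (2 * (`|K| + 1))^-1)).
  apply: (@le_trans _ _ (`|K| * r)); first by rewrite ler_wpM2r ?ler_norm// ltW.
  by rewrite ler_wpM2l// ge_min lexx orbT.
rewrite ltr_pdivrMr// mul1r; have := normr_ge0 K; lra.
Qed.

Lemma dual_max_moments (lam : 'I_n.+1 -> R) : (forall f, 0 < cos_poly lam f) ->
  (forall nu, (forall f, 0 <= cos_poly nu f) -> dual nu <= dual lam) ->
  forall l : 'I_n.+1, intI (fun f => psd_lam lam f * cosn l f) = c l.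
Proof.
move=> P0 lmax l; have [f0 _ fmin] := cos_poly_min lam.
set a := cos_poly lam f0 in fmin; have a0 : 0 < a by exact: P0.
set s := Num.sqrt a; have s0 : 0 < s by rewrite sqrtr_gt0.
have cS := continuous_psd_lam P0.
have cSc : continuous (fun f => psd_lam lam f * cosn l f).
  by apply: continuous_mulf => //; exact: continuous_cosn.
have cs := continuous_sqrt_cos_poly (lam:=lam).
apply/eqP; rewrite -subr_eq0; apply/eqP.
(* With a = min P, any |t| <= a keeps P + t cos nonnegative. The Taylor remainder is at most t^2 /
   (2 s^3) with s = sqrt a, and the factor 2 in [dual] doubles it. *)
apply: (@linear_le_quadratic _ (s ^+ 3)^-1 a a0) => t ta.
pose nu (i : 'I_n.+1) := lam i + t * (i == l)%:R.
have nuE g : \sum_i nu i * g i = \sum_i lam i * g i + t * g l.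
  rewrite /nu; under eq_bigr do rewrite mulrDl.
  rewrite big_split /=; congr (_ + _); rewrite (bigD1 l)//= eqxx mulr1 big1 ?addr0//.
  by move=> i /negbTE ->; rewrite mulr0 mul0r.
have NE f : cos_poly nu f = cos_poly lam f + t * cosn l f.
  by rewrite cos_poly_cosn (nuE (fun i => cosn i f)).
have tc f : `|t * cosn l f| <= a.
  by rewrite normrM (le_trans _ ta)// ler_piMr// cosn_le1.
have N0 f : 0 <= cos_poly nu f.
  rewrite NE; have := fmin f; have := tc f; rewrite ler_norml => /andP[h _] h'; lra.
have := lmax nu N0; rewrite /dual nuE => hd.
have It : intI (fun f => Num.sqrt (cos_poly lam f)) +
    t / 2 * intI (fun f => psd_lam lam f * cosn l f) - t ^+ 2 / (2 * s ^+ 3) <=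
    intI (fun f => Num.sqrt (cos_poly nu f)).
  rewrite -intIZ// -intID//; last by apply: continuous_mulf => //; exact: continuous_cstf.
  have c3 : continuous (fun f => Num.sqrt (cos_poly lam f) + t / 2 * (psd_lam lam f * cosn l f)).
    by apply: continuous_addf => //; apply: continuous_mulf => //; exact: continuous_cstf.
  rewrite -[X in _ - X]intI_cst -intIB//; last exact: continuous_cstf.
  apply: le_intI.
  - by apply: continuous_subf => //; exact: continuous_cstf.
  - exact: continuous_sqrt_cos_poly.
  move=> f _; apply: le_trans (sqrt_taylor (P0 f) (N0 f)).
  rewrite NE [_ + t * _ - _]addrAC subrr add0r.
  set r := Num.sqrt (cos_poly lam f).
  have r0 : 0 < r by rewrite sqrtr_gt0.
  have -> : t * cosn l f / (2 * r) = t / 2 * (psd_lam lam f * cosn l f).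
    by rewrite /psd_lam -/r; field; rewrite gt_eqF.
  rewrite lerD2l lerN2 ler_pM ?sqr_ge0 ?invr_ge0 ?mulr_ge0 ?exprn_ge0 ?(ltW r0)//.
    rewrite exprMn ler_piMr ?sqr_ge0// -[leLHS]real_normK ?num_real//.
    by rewrite expr_le1// cosn_le1.
  rewrite lef_pV2 ?posrE ?mulr_gt0 ?exprn_gt0// ler_pM2l// lerXn2r ?nnegrE ?(ltW s0) ?(ltW r0)//.
  by rewrite ler_wsqrtr.
have s3 : t ^+ 2 / (2 * s ^+ 3) = (s ^+ 3)^-1 * t ^+ 2 / 2.
  by field; rewrite gt_eqF.
rewrite s3 in It; move: hd It.
set I1 := intI _; set I2 := intI _; set I3 := intI _; set L := \sum_i _.
set X := (_ * t ^+ 2); nra.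
Qed.

Lemma lam_solution_exists : exists lam : 'I_n.+1 -> R,
  (forall f, 0 < cos_poly lam f) /\
  forall l : 'I_n.+1, intI (fun f => psd_lam lam f * cosn l f) = c l.
Proof.
have [lam P0 lmax] := dual_max.
have Ppos := dual_max_pos P0 lmax.
by exists lam; split => //; exact: dual_max_moments.
Qed.

End DualProblem.

(** * Covariances of stationary processes *)

Section Processes.
Context {R : realType}.
Implicit Types X Y : wss_process R.

Lemma Lfun1_rvM X i j :
  (wss_rv X i : wss_sample X -> R) * (wss_rv X j : wss_sample X -> R)
    \in Lfun (wss_prob X) 1.
Proof. by apply: Lfun2_mul_Lfun1; exact: wss_L2. Qed.

Lemma Lfun1_rv X i : (wss_rv X i : wss_sample X -> R) \in Lfun (wss_prob X) 1.
Proof.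
apply: Lfun_subset12; last exact: wss_L2.
by rewrite fin_num_measure.
Qed.

Lemma expectation_rvM_shift X i j :
  'E_(wss_prob X)[(wss_rv X i : wss_sample X -> R) * wss_rv X j]%E =
  (autocov X (i - j))%:E.
Proof.
have := wss_stationary X j (i - j); rewrite addrC subrK => ->.
by rewrite /autocov fineK// expectation_fin_num// Lfun1_rvM.
Qed.

Lemma autocovN X l : autocov X (- l) = autocov X l.
Proof.
apply/EFin_inj; rewrite -[in RHS](subr0 l) -[- l]sub0r -!expectation_rvM_shift.
by rewrite mulrC.
Qed.

Lemma autocov_abs X l : autocov X `|l|%N%:Z = autocov X l.
Proof.
have [l0|l0] := leP 0 l; first by rewrite gez0_abs.
by rewrite ltz0_abs// autocovN.
Qed.

Lemma autocov_dist X (i j : nat) : autocov X `|i - j|%N%:Z = autocov X (i%:Z - j%:Z).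
Proof. exact: autocov_abs. Qed.

Lemma sample_cov_mx X k n : sample_cov X k n = cov_mx X n.
Proof.
apply/matrixP => i j; rewrite !mxE covarianceE ?Lfun1_rv ?Lfun1_rvM//.
rewrite !wss_mean0 mule0 sube0 expectation_rvM_shift /= autocov_dist.
by congr autocov; ring.
Qed.

Lemma fine_expectation_sum X (I : Type) (r : seq I) (F : I -> wss_sample X -> R) :
  (forall i, F i \in Lfun (wss_prob X) 1) ->
  (\sum_(i <- r) F i) \in Lfun (wss_prob X) 1 /\
  fine ('E_(wss_prob X)[\sum_(i <- r) F i])%E =
    \sum_(i <- r) fine ('E_(wss_prob X)[F i])%E.
Proof.
move=> LF; elim: r => [|i r [IH1 IH2]].
  rewrite !big_nil; split; first exact: (Lfun_cst _ 0 1).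
  by have -> : (0 : wss_sample X -> R) = cst 0 by []; rewrite expectation_cst.
rewrite !big_cons -IH2; split; first by rewrite rpredD.
rewrite expectationD// fineD// expectation_fin_num//.
Qed.

Lemma possemidef_cov X n : possemidef (toeplitz n (fun l => autocov X l%:Z)).
Proof.
split; first exact: toeplitz_sym.
move=> v; pose F (i j : 'I_n) : wss_sample X -> R :=
  (v 0 i * v 0 j) \o* ((wss_rv X (i : nat)%:Z : wss_sample X -> R) * wss_rv X (j : nat)%:Z).
have LF i j : F i j \in Lfun (wss_prob X) 1.
  by apply: Lfun_scale => //; exact: Lfun1_rvM.
have EF i j : fine ('E_(wss_prob X)[F i j])%E =
    v 0 i * toeplitz n (fun l => autocov X l%:Z) i j * v 0 j.
  rewrite mxE autocov_dist /F.
  rewrite expectationZl ?Lfun1_rvM// expectation_rvM_shift /=; ring.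
rewrite qformE.
have -> : \sum_i \sum_j v 0 i * toeplitz n (fun l => autocov X l%:Z) i j * v 0 j =
    fine ('E_(wss_prob X)[\sum_i \sum_j F i j])%E.
  have LS i := fine_expectation_sum (index_enum 'I_n) (LF i).
  rewrite (fine_expectation_sum _ (fun i => (LS i).1)).2.
  by apply: eq_bigr => i _; rewrite (LS i).2; apply: eq_bigr => j _; rewrite EF.
apply: fine_ge0; apply: expectation_ge0 => w.
have -> : (\sum_i \sum_j F i j) w = (\sum_i v 0 i * wss_rv X (i : nat)%:Z w) ^+ 2.
  rewrite fct_sumE expr2 mulr_suml; apply: eq_bigr => i _.
  rewrite fct_sumE mulr_sumr; apply: eq_bigr => j _.
  by rewrite /F /= -[(_ * _) w]/(_ * _); ring.
exact: sqr_ge0.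
Qed.

Lemma consistentP X n (c : nat -> R) :
  consistent X (toeplitz n.+1 c) <-> forall l, (l < n.+1)%N -> autocov X l%:Z = c l.
Proof.
split=> [h l ln|h k].
  have := h 0; rewrite sample_cov_mx => /matrixP/(_ (Ordinal ln) ord0).
  by rewrite !mxE /= addn0.
rewrite sample_cov_mx; apply/matrixP => i j; rewrite !mxE; apply: h.
exact: absdiff_lt.
Qed.

End Processes.

(** * Optimality, and passage between the cosine and product forms *)

Section Optimality.
Context {R : realType}.
Variables (n : nat) (c : nat -> R).

Lemma moment_constraintsP (S : R -> R) : continuous S ->
  moment_constraints n.+1 c S <->
  forall l, (l < n.+1)%N -> intI (fun f => S f * cosn l f) = c l.
Proof.
move=> cS; have cSc l : continuous (fun f => S f * cosn l f).
  by apply: continuous_mulf => //; exact: continuous_cosn.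
split=> h l ln; first by apply/EFin_inj; rewrite -intI_EFin// -h.
by rewrite -h// -intI_EFin.
Qed.

Lemma psd_lam_bounds (lam : 'I_n.+1 -> R) : (forall f, 0 < cos_poly lam f) ->
  exists s B, 0 < s /\ forall f, s <= psd_lam lam f <= B.
Proof.
move=> P0; have [f0 _ fmin] := cos_poly_min lam; have a0 := P0 f0.
exists (Num.sqrt (\sum_l `|lam l|))^-1, (Num.sqrt (cos_poly lam f0))^-1.
have PB f : cos_poly lam f <= \sum_l `|lam l|.
  exact: le_trans (ler_norm _) (cos_poly_le _ _).
have B0 : 0 < \sum_l `|lam l| by exact: lt_le_trans a0 (PB f0).
split; first by rewrite invr_gt0 sqrtr_gt0.
by move=> f; rewrite /psd_lam !lef_pV2 ?posrE ?sqrtr_gt0// !ler_wsqrtr.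
Qed.

Lemma psd_lam_optimal (lam : 'I_n.+1 -> R) :
  lam_solution c lam -> psd_optimal (toeplitz n.+1 c) (psd_lam lam).
Proof.
move=> [P0 mom]; have cS := continuous_psd_lam P0.
have {}mom := (moment_constraintsP cS).1 mom.
have [s [B [s0 sB]]] := psd_lam_bounds P0.
have Ss f : s <= psd_lam lam f by have /andP[] := sB f.
have SB f : psd_lam lam f <= B by have /andP[] := sB f.
have S0 f : 0 <= psd_lam lam f by exact: le_trans (ltW s0) (Ss f).
have evS f : psd_lam lam (- f) = psd_lam lam f by rewrite /psd_lam cos_polyN.
pose X := harmonic_process cS S0 SB evS.
have XE l : autocov X l = intI (fun f => cosn `|l|%N f * psd_lam lam f).
  exact: autocov_harmonic.
(* S P = sqrt P makes the duality gap vanish: integrated, it turns the moment constraints into sum_l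
   lam_l c_l = \int sqrt P. *)
have sqV f : psd_lam lam f * cos_poly lam f = Num.sqrt (cos_poly lam f).
  rewrite /psd_lam -{2}(sqr_sqrtr (ltW (P0 f))) expr2 mulrA mulVf ?mul1r//.
  by rewrite gt_eqF// sqrtr_gt0.
have LV : \sum_l lam l * c l = intI (fun f => Num.sqrt (cos_poly lam f)).
  rewrite -(@eq_intI _ _ (fun f => Num.sqrt (cos_poly lam f)) (fun f => sqV f)).
  under [RHS]eq_intI do rewrite mulrC.
  rewrite intI_cos_poly_mul//; apply: eq_bigr => l _; rewrite -mom//.
  by congr (_ * _); apply: eq_intI => f; rewrite mulrC.
exists X; split.
- apply: has_psd_autocov => // f; exact: fourier_sum_cvg.
- apply/consistentP => l ln; rewrite XE -mom//.
  by apply: eq_intI => f; rewrite mulrC.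
move=> Y _ /consistentP YE.
apply: (@le_trans _ _ (intI (fun f => Num.sqrt (cos_poly lam f)))%:E).
  have := @limn_mean_trace_inv_le _ _ (fun l => autocov X l%:Z) s cS s0 Ss (fun l => XE l).
  by under eq_intI do rewrite /psd_lam invrK.
have := limn_mean_trace_inv_ge (possemidef_cov Y) (fun f => ltW (P0 f)).
have -> : \sum_l lam l * autocov Y (l : nat)%:Z = \sum_l lam l * c l.
  by apply: eq_bigr => l _; rewrite YE.
by rewrite LV mulr_natl mulr2n addrK.
Qed.

Lemma root_prod_ge0 m (xi : 'I_m -> R[i]) f : 0 <= root_prod xi f.
Proof. by apply: prodr_ge0 => k _; case: (_ - _) => a b; exact: sqrtr_ge0. Qed.

Lemma psd_lam_xi (lam : 'I_n.+1 -> R) : (forall f, 0 < cos_poly lam f) ->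
  exists (gam : R) (xi : 'I_n -> R[i]), [/\ 0 < gam, forall f, 0 < root_prod xi f &
    psd_xi gam xi = psd_lam lam].
Proof.
move=> P0; have [K [xi [K0 PE]]] := cos_poly_root_prod P0.
have rp0 f : 0 < root_prod xi f.
  rewrite lt_neqAle root_prod_ge0 andbT eq_sym.
  by have := P0 f; apply: contraTneq; rewrite PE => ->; rewrite expr0n mulr0 ltxx.
exists (Num.sqrt K)^-1, xi; split => //; first by rewrite invr_gt0 sqrtr_gt0.
apply/funext => f; rewrite /psd_lam /psd_xi PE sqrtrM ?ltW// sqrtr_sqr.
by rewrite gtr0_norm// invfM.
Qed.

(** The symbol is P = (root_prod / gam)^2. Evenness of the density passes to the product, which
    makes its square a cosine polynomial. *)
Lemma psd_xi_lam gam (xi : 'I_n -> R[i]) : 0 < gam -> (forall f, 0 < root_prod xi f) ->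
  (forall f, psd_xi gam xi (- f) = psd_xi gam xi f) ->
  exists lam : 'I_n.+1 -> R,
    (forall f, 0 < cos_poly lam f) /\ psd_lam lam = psd_xi gam xi.
Proof.
move=> g0 rp0 ev.
have evr f : root_prod xi (- f) = root_prod xi f.
  apply: invr_inj; apply: (@mulfI _ gam); first by rewrite gt_eqF.
  exact: ev.
have [lam lamE] := even_trigZ (gam ^- 2) (root_prod_even_trig evr).
have PE f : cos_poly lam f = (root_prod xi f / gam) ^+ 2.
  by rewrite -lamE expr_div_n mulrC.
exists lam; split=> [f|]; first by rewrite PE exprn_gt0// divr_gt0.
apply/funext => f; rewrite /psd_lam PE sqrtr_sqr gtr0_norm ?divr_gt0//.
by rewrite invfM invrK mulrC.
Qed.

End Optimality.

Theorem theorem3 (R : realType) (m : nat) (c : m.-tuple R)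
  (m_gt0 : (0 < m)%N)
  (C_posdef : posdef (toeplitz m (nth 0 c)))
  (C_cov : exists X : wss_process R, consistent X (toeplitz m (nth 0 c))) :
  [/\ exists lam : 'I_m -> R, lam_solution (nth 0 c) lam,
      forall lam : 'I_m -> R, lam_solution (nth 0 c) lam ->
        psd_optimal (toeplitz m (nth 0 c)) (psd_lam lam) /\
        exists (gam : R) (xi : 'I_m.-1 -> R[i]),
          xi_solution (nth 0 c) gam xi /\
          forall f : R, psd_lam lam f = psd_xi gam xi f &
      forall (gam : R) (xi : 'I_m.-1 -> R[i]), xi_solution (nth 0 c) gam xi ->
        psd_optimal (toeplitz m (nth 0 c)) (psd_xi gam xi) /\
        exists lam : 'I_m -> R,
          lam_solution (nth 0 c) lam /\
          forall f : R, psd_xi gam xi f = psd_lam lam f].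
Proof.
case: m c m_gt0 C_posdef {C_cov} => // n c _ pT.
split.
- have [lam [P0 mom]] := lam_solution_exists pT.
  exists lam; split=> //; apply/moment_constraintsP; first exact: continuous_psd_lam.
  by move=> l ln; exact: (mom (Ordinal ln)).
- move=> lam sol; split; first exact: psd_lam_optimal.
  have [P0 mom] := sol.
  have [gam [xi [g0 rp0 psdE]]] := psd_lam_xi P0.
  exists gam, xi; split; last by move=> f; rewrite psdE.
  by split=> // [f|]; rewrite psdE// /psd_lam cos_polyN.
- move=> gam xi [g0 rp0 ev mom].
  have [lam [P0 psdE]] := psd_xi_lam g0 rp0 ev.
  have sol : lam_solution (nth 0 c) lam by split=> //; rewrite psdE.
  by rewrite -psdE; split; [exact: psd_lam_optimal|exists lam].
Qed.
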